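(* For every $p\in(0,1]$ there are positive constants $c_1(p),c_2(p)$, depending only on $p$, such that the following holds. Let $M_1,M_2$ be functions on $[0,1]$ such that $t\mapsto M_1(t^{1/p})$ and $t\mapsto M_2(t^{1/p})$ are Orlicz functions, with fundamental functions $\varphi_{M_1},\varphi_{M_2}$, and assume that $\varphi_{M_1}/\varphi_{M_2}$ is non-decreasing on $[1,\infty)$. Then for all $k,n\in\mathbb{N}$, with $id:\ell_{M_1}^n\to\ell_{M_2}^n$ the identity map, $$c_1(p)\,A(n,k)\le e_k(id:\ell_{M_1}^n\to\ell_{M_2}^n)\le c_2(p)\,A(n,k),$$ where $$A(n,k)=\begin{cases}1&\text{if }1\le k\le\log(2n),\\[1mm] \dfrac{\varphi_{M_2}\left(k/\log(2n/k)\right)}{\varphi_{M_1}\left(k/\log(2n/k)\right)}&\text{if }\log(2n)\le k\le n,\\[3mm] 2^{-k/n}\,\dfrac{\varphi_{M_2}(n)}{\varphi_{M_1}(n)}&\text{if }k\ge n\end{cases}$$ (where the ranges overlap, the estimate is asserted for each applicable value of $A(n,k)$).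
   Context: All spaces are real; $\log=\log_2$; $\mathbb{N}=\{1,2,\dots\}$. Orlicz function: a continuous, strictly increasing, convex function $N:[0,1]\to\mathbb{R}$ with $N(0)=0$, $N(1)=1$. For $M$ on $[0,1]$ such that $t\mapsto M(t^{1/p})$ is an Orlicz function for some $p\in(0,1]$, $\ell_M^n$ denotes $\mathbb{R}^n$ with the $p$-norm $\|x\|_{\ell_M}=\inf\{\varrho>0:\ \sum_{i=1}^n M(|x_i|/\varrho)\le 1\}$. Convention: $M(t)=+\infty$ for $t>1$, so only $\varrho$ with $|x_i|\le\varrho$ for all $i$ are admissible. Fundamental function: $\varphi_M(t)=1/M^{-1}(1/t)$ for $t\ge1$. Entropy numbers: for a continuous linear map $T:X\to Y$ between quasi-Banach spaces with closed unit balls $B_X,B_Y$, $e_k(T)=\inf\{\varepsilon>0:\ T(B_X)\subset\bigcup_{i=1}^{2^{k-1}}(y_i+\varepsilon B_Y)\text{ for some }y_1,\dots,y_{2^{k-1}}\in Y\}$. *)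

(* Defs.v *)
From HB Require Import structures.
From mathcomp Require Import all_boot all_order all_algebra.
From mathcomp Require Import all_classical all_reals all_analysis.

Set Implicit Arguments.
Unset Strict Implicit.
Unset Printing Implicit Defensive.

Import Order.TTheory GRing.Theory Num.Theory.
Import numFieldNormedType.Exports.

Local Open Scope classical_set_scope.
Local Open Scope ring_scope.

Definition log2 (R : realType) (x : R) : R := ln x / ln 2.

(* Functions on [0, 1] are total functions R -> R of which only the values on
   [0, 1] are ever constrained or used. *)
Definition orlicz (R : realType) (N : R -> R) : Prop :=
  [/\ {within `[0, 1]%classic, continuous N},
      {in `[0, 1] &, {homo N : x y / x < y}},
      @convex_function R R^o `[0, 1]%classic N,
      N 0 = 0
    & N 1 = 1].

Definition p_orlicz (R : realType) (p : R) (M : R -> R) : Prop :=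
  orlicz (fun t : R => M (t `^ p^-1)).

(* The condition `|x i| <= rho expresses the convention M t = +oo for t > 1. *)
Definition orlicz_norm (R : realType) (M : R -> R) (n : nat) (x : 'rV[R]_n) : R :=
  inf [set rho : R | [/\ 0 < rho,
                         forall i, `|x ord0 i| <= rho
                       & \sum_(i < n) M (`|x ord0 i| / rho) <= 1]].

Definition orlicz_inv (R : realType) (M : R -> R) : R -> R :=
  'pinv_(fun=> 0) `[0, 1]%classic M.

Definition fundamental (R : realType) (M : R -> R) (t : R) : R :=
  (orlicz_inv M t^-1)^-1.

Definition unit_ball (R : realType) (U : lmodType R) (normU : U -> R) : set U :=
  [set x | normU x <= 1].

(* The quasi-norms of the two spaces are passed as functions. *)
Definition entropy_number (R : realType) (U V : lmodType R)
    (normU : U -> R) (normV : V -> R) (T : U -> V) (k : nat) : R :=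
  inf [set eps : R | 0 < eps /\
        exists y : 'I_(2 ^ k.-1) -> V,
          T @` unit_ball normU `<=`
            \bigcup_(i in [set: 'I_(2 ^ k.-1)])
              [set y i + eps *: b | b in unit_ball normV]].

(* Main.v *)
(* Up to a factor 2 both unit balls may be replaced by the modular balls
   {x : sum_i M |x_i| <= 1}.

   Upper bounds. Write m for a real number in [1, n] and round each coordinate
   of a point of the ball of M1 towards 0 to a multiple of 1 / phi1 m. Convexity
   of t |-> M1 (t^(1/p)) gives sum_i b_i^p <= m for the multiples b_i, so there
   are at most exp (m (2/p + 4 + ln (n/m))) roundings. The rounding errors are at
   most 1 / phi1 m, where the monotonicity of phi1 / phi2 says that
   M2 (t phi1 m / phi2 m) <= M1 t; hence they lie in phi2 m / phi1 m times the
   ball of M2. A multiple m of k / log (2n/k) settles the range k <= n; for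
   k >= n one takes m = n and subdivides the cubes of side 1 / phi1 n.

   Lower bounds. For small k use 0 and the unit vectors. For k >= n/648, and for
   k >= n, compare a grid in the ball of M1 with the rounding cubes of the ball
   of M2 at m = n. In the remaining cases split the coordinates into m ~ 8u
   blocks, u = k / log (2n/k), and take the vectors with one entry 1 / phi1 m in
   each block: a ball of radius c phi2 m / phi1 m contains only vectors whose
   choice functions agree with a fixed one in half of the blocks. *)
Require Import Defs.
From HB Require Import structures.
From mathcomp Require Import all_boot all_order all_algebra.
From mathcomp Require Import all_classical all_reals all_analysis.
From mathcomp Require Import ring lra.

Set Implicit Arguments.
Unset Strict Implicit.
Unset Printing Implicit Defensive.

Import Order.TTheory GRing.Theory Num.Theory.
Import numFieldNormedType.Exports.

Local Open Scope classical_set_scope.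
Local Open Scope ring_scope.

(** * Real powers with exponents p and 1/p *)

Section PowR.
Context {R : realType}.
Implicit Types p s t x : R.

Lemma powRK p x : p != 0 -> 0 <= x -> (x `^ p) `^ p^-1 = x.
Proof. by move=> p0 x0; rewrite -powRrM divff// powRr1. Qed.

Lemma powRVK p x : p != 0 -> 0 <= x -> (x `^ p^-1) `^ p = x.
Proof. by move=> p0 x0; rewrite -powRrM mulVf// powRr1. Qed.

Lemma pow1R p : 1 `^ p = 1 :> R.
Proof. by rewrite powR1. Qed.

Lemma powR_itv01 p x : 0 <= p -> 0 <= x <= 1 -> 0 <= x `^ p <= 1.
Proof.
move=> p0 /andP[x0 x1]; rewrite powR_ge0/= -[leRHS](pow1R p).
by rewrite ge0_ler_powR// nnegrE.
Qed.

Lemma powR_ge1 p x : 0 <= p -> 1 <= x -> 1 <= x `^ p.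
Proof.
move=> p0 x1; rewrite -[leLHS](pow1R p).
by rewrite ge0_ler_powR// nnegrE ?ler01// (le_trans ler01).
Qed.

Lemma powRV1 p x : 0 <= x -> x^-1 `^ p = (x `^ p)^-1.
Proof.
by move=> x0; rewrite -powRN -powR_inv1// -powRrM mulN1r.
Qed.

End PowR.

(** * Growth of p-convex Orlicz functions and of their fundamental functions *)

Section POrlicz.
Context {R : realType} (p : R) (M : R -> R).
Hypotheses (p0 : 0 < p) (oM : p_orlicz p M).
Local Notation phi := (fundamental M).
Implicit Types c s t l m : R.

Let pn0 : p != 0. Proof. by rewrite gt_eqF. Qed.

Lemma p_orlicz0 : M 0 = 0.
Proof. by case: oM => _ _ _ + _; rewrite powR0// invr_eq0. Qed.

Lemma p_orlicz1 : M 1 = 1.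
Proof. by case: oM => _ _ _ _ +; rewrite powR1. Qed.

Lemma p_orlicz_lt s t : 0 <= s -> s < t -> t <= 1 -> M s < M t.
Proof.
move=> s0 st t1; case: oM => _ N_lt _ _ _.
have t0 : 0 <= t by rewrite (le_trans s0)// ltW.
rewrite -(powRK pn0 s0) -(powRK pn0 t0); apply: N_lt.
- by rewrite in_itv/= powR_itv01// ?(ltW p0)// s0 (le_trans (ltW st)).
- by rewrite in_itv/= powR_itv01// ?(ltW p0)// t0 t1.
- by rewrite gt0_ltr_powR// nnegrE.
Qed.

Lemma p_orlicz_le s t : 0 <= s -> s <= t -> t <= 1 -> M s <= M t.
Proof.
move=> s0; rewrite le_eqVlt => /predU1P[->//|st] t1.
exact/ltW/p_orlicz_lt.
Qed.

Lemma p_orlicz_ge0 t : 0 <= t -> t <= 1 -> 0 <= M t.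
Proof. by move=> t0 t1; rewrite -p_orlicz0 p_orlicz_le. Qed.

Lemma p_orlicz_le_inv s t : 0 <= t -> s <= 1 -> M s <= M t -> s <= t.
Proof.
move=> t0 s1; apply: contraTT; rewrite -!ltNge => ts.
exact: p_orlicz_lt.
Qed.

(** Convexity of t |-> M (t^(1/p)) on the segment from 0, where it vanishes, to t^p. *)
Lemma p_orlicz_scale l t : 0 <= l -> l <= 1 -> 0 <= t -> t <= 1 ->
  M (l `^ p^-1 * t) <= l * M t.
Proof.
move=> l0 l1 t0 t1; case: oM => _ _ Ncvx N0 _.
have l01 : Itv.spec (@Itv.num_sem R) (Itv.Real `[0%Z, 1%Z]) l.
  by rewrite /= /Itv.num_sem/= ger0_real//= in_itv/= l0 l1.
have /= := Ncvx (Itv.mk l01) (t `^ p) 0.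
rewrite !inE/= !in_itv/= powR_itv01// ?(ltW p0)// ?t0// => /(_ erefl).
rewrite lexx ler01 => /(_ erefl).
rewrite !convRE/= N0 !mulr0 !addr0 powRK//.
have -> : @conv R (convex_lmodType R^o) (Itv.mk l01) (t `^ p) 0 = l * t `^ p.
  by rewrite [LHS](_ : _ = l * t `^ p + (1 - l) * 0)// mulr0 addr0.
by rewrite powRM ?powR_ge0// powRK.
Qed.

Lemma p_orlicz_surj c : 0 <= c -> c <= 1 -> exists2 t, 0 <= t <= 1 & M t = c.
Proof.
move=> c0 c1; case: oM => Ncont _ _ N0 N1.
have [|t + <-] := IVT (v := c) (@ler01 R) Ncont.
  by rewrite N0 N1 minElt maxElt ltr01 c0 c1.
rewrite in_itv/= => t01; exists (t `^ p^-1) => //.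
by rewrite powR_itv01// invr_ge0 ltW.
Qed.

(** By the intermediate value theorem M maps [0, 1] onto [0, 1], so the pseudo-inverse is a right
    inverse there. *)
Lemma orlicz_invP c : 0 <= c -> c <= 1 ->
  0 <= orlicz_inv M c <= 1 /\ M (orlicz_inv M c) = c.
Proof.
move=> c0 c1; have surjM : set_surj `[0, 1]%classic `[0, 1]%classic M.
  move=> d /=; rewrite in_itv/= => /andP[d0 d1].
  have [t t01 Mt] := p_orlicz_surj d0 d1.
  by exists t => //=; rewrite in_itv.
split.
  have /(_ (orlicz_inv M c)) := surjpinv_image_sub (dflt := fun=> 0) surjM.
  rewrite /= in_itv/=; apply; exists c => //=.
  by rewrite in_itv/= c0.
by rewrite /orlicz_inv (surjpK (fun=> 0) surjM)// inE/= in_itv/= c0.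
Qed.

Lemma p_orlicz_fundV m : 1 <= m -> M (phi m)^-1 = m^-1.
Proof.
move=> m1; have m0 : 0 < m by rewrite (lt_le_trans ltr01).
rewrite /fundamental invrK; apply: (orlicz_invP _ _).2.
  by rewrite invr_ge0 ltW.
by rewrite invf_le1.
Qed.

Lemma fund_ge1 m : 1 <= m -> 1 <= phi m.
Proof.
move=> m1; have m0 : 0 < m by rewrite (lt_le_trans ltr01).
have [||/andP[i0 i1] Mi] := @orlicz_invP m^-1.
- by rewrite invr_ge0 ltW.
- by rewrite invf_le1.
rewrite /fundamental invf_ge1// lt_def i0 andbT.
apply/eqP => i_eq0; move: Mi; rewrite i_eq0 p_orlicz0 => /esym/eqP.
by rewrite invr_eq0 gt_eqF.
Qed.

Lemma fund_gt0 m : 1 <= m -> 0 < phi m.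
Proof. by move=> m1; rewrite (lt_le_trans ltr01)// fund_ge1. Qed.

Lemma fundV_le1 m : 1 <= m -> (phi m)^-1 <= 1.
Proof. by move=> m1; rewrite invf_le1 ?fund_gt0// fund_ge1. Qed.

Lemma fundV_ge0 m : 1 <= m -> 0 <= (phi m)^-1.
Proof. by move=> m1; rewrite invr_ge0 ltW// fund_gt0. Qed.

Lemma fund_le s t : 1 <= s -> s <= t -> phi s <= phi t.
Proof.
move=> s1 st; have t1 := le_trans s1 st.
rewrite -lef_pV2 ?posrE ?fund_gt0//; apply: p_orlicz_le_inv.
- exact: fundV_ge0.
- exact: fundV_le1.
- by rewrite !p_orlicz_fundV// lef_pV2// posrE (lt_le_trans ltr01).
Qed.

(** Compare reciprocals through M: by [p_orlicz_scale] with factor 1/l, M at l^(-1/p) / [phi t] is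
    at most 1/(l t), its value at 1 / [phi (l * t)]. *)
Lemma fund_scale l t : 1 <= l -> 1 <= t -> phi (l * t) <= l `^ p^-1 * phi t.
Proof.
move=> l1 t1; have lt1 : 1 <= l * t by rewrite mulr_ege1.
have l0 : 0 < l by rewrite (lt_le_trans ltr01).
have Vl1 : l^-1 <= 1 by rewrite invf_le1.
have Vl0 : 0 <= l^-1 by rewrite invr_ge0 ltW.
have /andP[m0 m1] : 0 <= l^-1 `^ p^-1 <= 1.
  by rewrite powR_itv01 ?Vl0// invr_ge0 ltW.
rewrite -lef_pV2 ?posrE ?mulr_gt0 ?powR_gt0 ?fund_gt0//.
rewrite invfM -powRV1 ?(ltW l0)//; apply: p_orlicz_le_inv.
- exact: fundV_ge0.
- by rewrite mulr_ile1// ?fundV_ge0 ?fundV_le1.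
- rewrite p_orlicz_fundV// invfM -(p_orlicz_fundV t1).
  by rewrite p_orlicz_scale// ?fundV_ge0 ?fundV_le1.
Qed.

Lemma fund_le_powR t : 1 <= t -> phi t <= t `^ p^-1.
Proof.
move=> t1; have := fund_scale t1 (lexx 1).
rewrite mulr1 => /le_trans; apply.
rewrite -[leRHS]mulr1 ler_pM2l ?powR_gt0 ?(lt_le_trans ltr01)//.
rewrite -invf_ge1 ?fund_gt0//; apply: p_orlicz_le_inv => //.
  exact: fundV_ge0.
by rewrite p_orlicz_fundV// invr1 p_orlicz1.
Qed.

(** [p_orlicz_scale] shrinks s to 1 / [phi m], where M equals 1/m. The bound charges each large
    coordinate the p-th power of its size in units of 1 / [phi m]. *)
Lemma p_orlicz_lower m s : 1 <= m -> (phi m)^-1 <= s -> s <= 1 ->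
  (s * phi m) `^ p / m <= M s.
Proof.
move=> m1 ms s1; have m0 : 0 < m by rewrite (lt_le_trans ltr01).
have f0 := fund_gt0 m1.
have s0 : 0 < s by rewrite (lt_le_trans _ ms)// invr_gt0.
have sf1 : 1 <= s * phi m by rewrite -ler_pdivrMr// mul1r.
have sf0 : 0 < s * phi m by rewrite mulr_gt0.
have /andP[l0 l1] : 0 <= (s * phi m)^-1 `^ p <= 1.
  by rewrite powR_itv01 ?(ltW p0)// invr_ge0 (ltW sf0) invf_le1.
have := p_orlicz_scale l0 l1 (ltW s0) s1.
rewrite powRK// ?invr_ge0 ?(ltW sf0)// invfM mulrAC mulVf ?gt_eqF// mul1r.
rewrite p_orlicz_fundV// -invfM powRV1 ?(ltW sf0)// => h.
by rewrite -ler_pdivlMl ?powR_gt0.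
Qed.

End POrlicz.

(* The modular ball is the unit ball of l_M^n up to attainment of the infimum in
   the quasi-norm; the factor 2 in the comparisons below avoids any limiting
   argument. *)
Definition modular_ball (R : realType) (M : R -> R) (n : nat) (x : 'rV[R]_n) :=
  (forall i, `|x ord0 i| <= 1) /\ \sum_(i < n) M `|x ord0 i| <= 1.

Definition covered (R : realType) (M1 M2 : R -> R) (n K : nat) (r : R) :=
  0 < r /\ exists y : 'I_K -> 'rV[R]_n, forall x, modular_ball M1 x ->
    exists i, modular_ball M2 (r^-1 *: (x - y i)).

(** * Modular balls versus unit balls of the quasi-norm *)

Section ModularBall.
Context {R : realType} (p : R) (M : R -> R).
Hypotheses (p0 : 0 < p) (oM : p_orlicz p M).
Variable n : nat.
Implicit Types (x y : 'rV[R]_n) (l m : R).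

Lemma modular_ball_le x y : (forall i, `|x ord0 i| <= `|y ord0 i|) ->
  modular_ball M y -> modular_ball M x.
Proof.
move=> xy [y1 My]; split=> [i|]; first by rewrite (le_trans (xy i)).
apply: le_trans My; apply: ler_sum => i _.
by rewrite (p_orlicz_le p0 oM).
Qed.

Lemma modular_ball_scale l x : 0 <= l -> l <= 1 ->
  modular_ball M x -> modular_ball M (l *: x).
Proof.
move=> l0 l1; apply: modular_ball_le => i.
by rewrite mxE normrM ger0_norm// ler_piMl.
Qed.

(** Each of the n coordinates contributes at most M (1 / [phi m]) = 1/m. *)
Lemma modular_ball_small m x : 1 <= m -> n%:R <= m ->
  (forall i, `|x ord0 i| <= (fundamental M m)^-1) -> modular_ball M x.
Proof.
move=> m1 nm x_le; split=> [i|].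
  by rewrite (le_trans (x_le i))// (fundV_le1 p0 oM).
have m0 : 0 < m by rewrite (lt_le_trans ltr01).
apply: (@le_trans _ _ (\sum_(i < n) m^-1)).
  apply: ler_sum => i _; rewrite -(p_orlicz_fundV p0 oM m1).
  by rewrite (p_orlicz_le p0 oM)// (fundV_le1 p0 oM).
by rewrite sumr_const card_ord -mulr_natl ler_pdivrMr// mul1r.
Qed.

Let admissible x := [set rho : R | [/\ 0 < rho, forall i, `|x ord0 i| <= rho
                       & \sum_(i < n) M (`|x ord0 i| / rho) <= 1]].

Lemma admissible_ball x rho :
  admissible x rho <-> 0 < rho /\ modular_ball M (rho^-1 *: x).
Proof.
have E rho0 i : 0 < rho0 -> `|(rho0^-1 *: x) ord0 i| = `|x ord0 i| / rho0.
  by move=> r0; rewrite mxE normrM ger0_norm ?invr_ge0 ?(ltW r0)// mulrC.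
split=> [[r0 xr Mx]|[r0 [xr Mx]]].
  split=> //; split=> [i|]; first by rewrite E// ler_pdivrMr// mul1r.
  by apply: le_trans Mx; apply: ler_sum => i _; rewrite E.
split=> // [i|]; first by have := xr i; rewrite E// ler_pdivrMr// mul1r.
by apply: le_trans Mx; apply: ler_sum => i _; rewrite E.
Qed.

Let admissible_lbound x : has_lbound (admissible x).
Proof. by exists 0 => rho [/ltW]. Qed.

Lemma orlicz_norm_le1 x : modular_ball M x -> orlicz_norm M x <= 1.
Proof.
move=> Bx; apply: (ge_inf (admissible_lbound x)).
by apply/admissible_ball; rewrite ltr01 invr1 scale1r.
Qed.

Lemma modular_ball_half x : orlicz_norm M x <= 1 -> modular_ball M (2^-1 *: x).
Proof.
move=> Nx.
(* The infimum of the empty set is 0, so an admissible radius has to be exhibited. Taking m = n + 1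
   keeps m >= 1 even for n = 0. *)
have adm_neq0 : admissible x !=set0.
  pose m : R := n.+1%:R; have m1 : 1 <= m by rewrite ler1n.
  pose rho := (1 + \sum_(i < n) `|x ord0 i|) * fundamental M m.
  have s0 : 0 < 1 + \sum_(i < n) `|x ord0 i|.
    by rewrite ltr_pwDl// sumr_ge0.
  have f0 := fund_gt0 p0 oM m1.
  have rho0 : 0 < rho by rewrite mulr_gt0.
  exists rho; apply/admissible_ball; split=> //.
  apply: (modular_ball_small m1); first by rewrite ler_nat.
  move=> i; rewrite mxE normrM gtr0_norm ?invr_gt0// /rho invfM mulrAC.
  apply: ler_piMl; first by rewrite invr_ge0 ltW.
  rewrite mulrC ler_pdivrMr// mul1r.
  by rewrite (bigD1 i)//= addrCA lerDl addr_ge0// sumr_ge0.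
have [rho rho_adm rho2] : exists2 rho, admissible x rho & rho < 2.
  apply: (inf_lt adm_neq0).
  by rewrite (le_lt_trans Nx)// ltr1n.
have [rho0 Bx] := (admissible_ball _ _).1 rho_adm.
have -> : 2^-1 *: x = (rho / 2) *: (rho^-1 *: x).
  by rewrite scalerA mulrAC divff ?mul1r// gt_eqF.
apply: modular_ball_scale => //; first by rewrite divr_ge0// ltW.
by rewrite ler_pdivrMr// mul1r ltW.
Qed.

End ModularBall.

(** * Entropy numbers through coverings of modular balls; comparison of M1 and M2 *)

Section Entropy.
Context {R : realType} (p : R) (M1 M2 : R -> R).
Hypotheses (p0 : 0 < p) (oM1 : p_orlicz p M1) (oM2 : p_orlicz p M2).
Variable n : nat.
Local Notation e k := (@entropy_number R 'rV[R]_n 'rV[R]_n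
  (@orlicz_norm R M1 n) (@orlicz_norm R M2 n) idfun k).

(** Lets centres be indexed by any finite set of codes; surplus indices receive the default centre
    0. *)
Lemma covered_finset (T : finType) (S : {set T}) (f : T -> 'rV[R]_n) K r :
  0 < r -> (#|S| <= K)%N ->
  (forall x : 'rV[R]_n, modular_ball M1 x ->
     exists2 t, t \in S & modular_ball M2 (r^-1 *: (x - f t))) ->
  covered M1 M2 n K r.
Proof.
move=> r0 SK Scov; split=> //.
exists (fun i => nth 0 [seq f t | t in S] i) => x /Scov[t tS Bt].
have tS' : t \in enum S by rewrite mem_enum.
have lt_i : (index t (enum S) < K)%N.
  by rewrite (leq_trans _ SK)// cardE index_mem.
exists (Ordinal lt_i) => /=.
by rewrite (nth_map t) ?index_mem// nth_index.
Qed.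

Lemma covered_widen K K' r : (K <= K')%N ->
  covered M1 M2 n K r -> covered M1 M2 n K' r.
Proof.
move=> KK' [r0 [y ycov]]; apply: (@covered_finset _ [set: 'I_K] y) => //.
  by rewrite cardsT card_ord.
by move=> x /ycov[i Bi]; exists i; rewrite ?inE.
Qed.

Let radii k := [set eps : R | 0 < eps /\
  exists y : 'I_(2 ^ k.-1) -> 'rV[R]_n,
    idfun @` unit_ball (@orlicz_norm R M1 n) `<=`
      \bigcup_(i in [set: 'I_(2 ^ k.-1)])
        [set y i + eps *: b | b in unit_ball (@orlicz_norm R M2 n)]].

Let radii_lbound k : has_lbound (radii k).
Proof. by exists 0 => eps [/ltW]. Qed.

Let covered_radii k r : covered M1 M2 n (2 ^ k.-1) r -> radii k (2 * r).
Proof.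
move=> [r0 [y ycov]]; split; first by rewrite mulr_gt0.
exists (fun i => 2 *: y i) => _ [x /= Nx <-].
have [i Bi] := ycov _ (modular_ball_half p0 oM1 Nx).
exists i => //=; exists (r^-1 *: (2^-1 *: x - y i)).
  by rewrite /unit_ball/= orlicz_norm_le1.
rewrite scalerA mulfK ?gt_eqF// scalerBr scalerA divff ?scale1r//.
by rewrite addrC subrK.
Qed.

Lemma entropy_le k r : covered M1 M2 n (2 ^ k.-1) r -> e k <= 2 * r.
Proof.
by move=> /covered_radii; apply: (ge_inf (radii_lbound k)).
Qed.

(** Some covering must exist, because the infimum over an empty set of radii would be 0. *)
Lemma entropy_ge k c : (exists r, covered M1 M2 n (2 ^ k.-1) r) ->
  (forall r, covered M1 M2 n (2 ^ k.-1) r -> c <= r) -> c / 2 <= e k.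
Proof.
move=> [r0 r0cov] c_le; apply: lb_le_inf.
  by exists (2 * r0); apply: covered_radii.
move=> eps [eps0 [y ycov]]; rewrite ler_pdivrMr// mulrC; apply: c_le.
split; first by rewrite mulr_gt0.
exists y => x Bx.
have [|i _ [b Nb xE]] := ycov x.
  by exists x => //; rewrite /unit_ball/= orlicz_norm_le1.
exists i; rewrite -xE addrC addKr scalerA.
have -> : (2 * eps)^-1 * eps = 2^-1.
  by rewrite invfM -mulrA mulVf ?mulr1// gt_eqF.
exact: (modular_ball_half p0 oM2).
Qed.

Hypothesis phi_mono : forall s t : R, 1 <= s -> s <= t ->
  fundamental M1 s / fundamental M2 s <= fundamental M1 t / fundamental M2 t.

Lemma fund1 (M : R -> R) : p_orlicz p M -> fundamental M 1 = 1.
Proof.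
move=> oM; apply/eqP; rewrite eq_le (fund_ge1 p0 oM)// andbT.
by have := fund_le_powR p0 oM (lexx 1); rewrite powR1.
Qed.

Lemma fund_ratioK (m t : R) : 1 <= m -> 0 <= t -> t <= (fundamental M1 m)^-1 ->
  fundamental M1 m / fundamental M2 m * t <= (fundamental M2 m)^-1.
Proof.
move=> m1 t0 tm; have f1 := fund_gt0 p0 oM1 m1; have f2 := fund_gt0 p0 oM2 m1.
rewrite mulrAC; apply: ler_piMl; first exact: fundV_ge0 p0 oM2 _ _.
by rewrite mulrC -ler_pdivlMr// mul1r.
Qed.

(** For t > 0 write t = 1 / phi1 s with s = 1 / M1 t >= m. Monotonicity replaces the ratio at m by
    the larger one at s, which turns t into 1 / phi2 s, where M2 equals 1/s = M1 t. *)
Lemma p_orlicz_compare (m t : R) :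
  1 <= m -> 0 <= t -> t <= (fundamental M1 m)^-1 ->
  M2 (fundamental M1 m / fundamental M2 m * t) <= M1 t.
Proof.
move=> m1; rewrite le_eqVlt => /predU1P[<- _|t0 tm].
  by rewrite mulr0 (p_orlicz0 p0 oM1) (p_orlicz0 p0 oM2).
have t1 : t <= 1 by rewrite (le_trans tm)// (fundV_le1 p0 oM1).
have Mt0 : 0 < M1 t by rewrite -(p_orlicz0 p0 oM1) (p_orlicz_lt p0 oM1).
have m0 : 0 < m by rewrite (lt_le_trans ltr01).
pose s := (M1 t)^-1.
have ms : m <= s.
  rewrite -[m]invrK lef_pV2 ?posrE ?invr_gt0// -(p_orlicz_fundV p0 oM1 m1).
  by rewrite (p_orlicz_le p0 oM1)// ?(ltW t0)// (fundV_le1 p0 oM1).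
have s1 := le_trans m1 ms.
have tE : t = (fundamental M1 s)^-1.
  have Mts : M1 (fundamental M1 s)^-1 = M1 t.
    by rewrite (p_orlicz_fundV p0 oM1 s1) /s invrK.
  apply/eqP; rewrite eq_le; apply/andP; split.
    by apply: (p_orlicz_le_inv p0 oM1); rewrite ?(fundV_ge0 p0 oM1)// Mts.
  by apply: (p_orlicz_le_inv p0 oM1); rewrite ?(fundV_le1 p0 oM1)// ?Mts// ltW.
rewrite -[leRHS]invrK -/s -(p_orlicz_fundV p0 oM2 s1).
apply: (p_orlicz_le p0 oM2); last by rewrite (fundV_le1 p0 oM2).
  have := fund_gt0 p0 oM1 m1; have := fund_gt0 p0 oM2 m1 => f2 f1.
  by rewrite mulr_ge0 ?divr_ge0// ltW.
apply: (@le_trans _ _ (fundamental M1 s / fundamental M2 s * t)).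
  by rewrite ler_pM2r// phi_mono.
by rewrite fund_ratioK// ?(ltW t0)// tE.
Qed.

(** The comparison at m = 1, where both fundamental functions equal 1. *)
Lemma modular_ball_sub (x : 'rV[R]_n) : modular_ball M1 x -> modular_ball M2 x.
Proof.
move=> [x1 Mx]; split=> //; apply: le_trans Mx; apply: ler_sum => i _.
have := @p_orlicz_compare 1 `|x ord0 i| (lexx 1) (normr_ge0 _).
by rewrite (fund1 oM1) (fund1 oM2) divr1 mul1r invr1; apply.
Qed.

Lemma covered1 K : (0 < K)%N -> covered M1 M2 n K 1.
Proof.
move=> K0; split=> //; exists (fun=> 0) => x Bx; exists (Ordinal K0).
by rewrite invr1 scale1r subr0; apply: modular_ball_sub.
Qed.

Lemma covered_exists k : exists r, covered M1 M2 n (2 ^ k.-1) r.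
Proof. by exists 1; apply: covered1; rewrite expn_gt0. Qed.

End Entropy.

(* Chernoff bound: each function counted contributes at least 1 to the
   expansion of exp(th m) times the product of the generating functions. *)
Lemma card_weight_le (R : realType) (I T : finType) (w : I -> T -> R)
    (m th B : R) : 0 <= th ->
  (forall i, \sum_t expR (- (th * w i t)) <= B) ->
  #|[set c : {ffun I -> T} | \sum_i w i (c i) <= m]%SET|%:R
    <= expR (th * m) * B ^+ #|I|.
Proof.
move=> th0 wB.
have -> : B ^+ #|I| = \prod_(i : I) B by rewrite prodr_const.
apply: (@le_trans _ _ (expR (th * m) *
    \prod_i \sum_t expR (- (th * w i t)))); last first.
  rewrite ler_pM2l ?expR_gt0//; apply: ler_prod => i _.
  by rewrite wB andbT sumr_ge0// => t _; exact: expR_ge0.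
rewrite bigA_distr_bigA/= mulr_sumr -sum1_card natr_sum.
rewrite [leRHS](bigID (fun c : {ffun I -> T} => \sum_i w i (c i) <= m))/=.
rewrite -[leLHS]addr0; apply: lerD; last first.
  rewrite sumr_ge0// => c _; rewrite mulr_ge0 ?expR_ge0// prodr_ge0//.
rewrite (eq_bigl (fun c : {ffun I -> T} => \sum_i w i (c i) <= m)); last first.
  by move=> c; rewrite inE.
apply: ler_sum => c cm.
rewrite -expR_sum -expRD -[leLHS]expR0 ler_expR sumrN -mulr_sumr -mulrBr.
by rewrite mulr_ge0// subr_ge0.
Qed.

Lemma sum_inv_sqr_le2 (R : realFieldType) (B : nat) :
  \sum_(j < B) (j.+1%:R ^+ 2)^-1 <= 2 :> R.
Proof.
(* The subtracted term makes the induction telescope. *)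
suff h : \sum_(j < B.+1) (j.+1%:R ^+ 2)^-1 <= 2 - B.+1%:R^-1 :> R.
  rewrite (le_trans _ (le_trans h _))// ?big_ord_recr/= ?lerDl ?invr_ge0//.
  by rewrite gerBl invr_ge0.
elim: B => [|B IH]; first by rewrite big_ord1 expr1n invr1; lra.
rewrite big_ord_recr/=; apply: (le_trans (lerD IH (lexx _))).
rewrite -subr_ge0.
set x : R := B.+1%:R; have x0 : 0 < x by rewrite ltr0n.
have -> : B.+2%:R = x + 1 :> R by rewrite -natr1.
have -> : 2 - (x + 1)^-1 - (2 - x^-1 + ((x + 1) ^+ 2)^-1) = (x * (x + 1) ^+ 2)^-1.
  by field; rewrite !gt_eqF// ltr_wpDl// ltW.
by rewrite invr_ge0 mulr_ge0 ?exprn_ge0// ?addr_ge0// ltW.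
Qed.

(** * Rounding codes for points of the modular ball *)

Section Coding.
Context {R : realType} (p : R) (M : R -> R).
Hypotheses (p0 : 0 < p) (oM : p_orlicz p M).
Local Notation phi := (fundamental M).

(** [None] stands for rounding to 0 and [Some (s, j)] for the multiple j + 1, negative if s is true.
    Weights are p-th powers of the multiples. *)
Definition quant_weight B (t : option (bool * 'I_B)) : R :=
  if t is Some (_, j) then j.+1%:R `^ p else 0.

Definition quant_value (a : R) B (t : option (bool * 'I_B)) : R :=
  if t is Some (s, j) then (-1) ^+ s * (j.+1%:R * a) else 0.

(** Since j^p >= 1 + p ln j and th p >= 2, each term is at most exp (- th) / j^2. The factor 4 is
    two signs times the bound 2 on the sum of 1/j^2. *)
Lemma quant_weight_gen (B : nat) (th : R) : 2 <= th * p ->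
  \sum_(t : option (bool * 'I_B)) expR (- (th * quant_weight t))
    <= 1 + 4 * expR (- th).
Proof.
move=> thp; have th0 : 0 <= th.
  by rewrite -(pmulr_lge0 _ p0) (le_trans _ thp).
rewrite (bigD1 None)//= mulr0 oppr0 expR0 lerD2l.
rewrite (reindex_omap Some id)/=; last by case.
rewrite (eq_bigl predT) => [|t]; last by rewrite /= eqxx.
rewrite (eq_bigr (fun t : bool * 'I_B => expR (- (th * t.2.+1%:R `^ p)))); last first.
  by case.
rewrite -(pair_bigA _ (fun (_ : bool) (j : 'I_B) => expR (- (th * j.+1%:R `^ p))))/=.
rewrite sumr_const card_bool mulr2n.
suff : \sum_(j < B) expR (- (th * j.+1%:R `^ p)) <= 2 * expR (- th) by lra.
apply: (@le_trans _ _ (\sum_(j < B) expR (- th) * (j.+1%:R ^+ 2)^-1)).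
  apply: ler_sum => j _.
  have l0 : 0 <= ln (j.+1%:R : R) by rewrite ln_ge0// ler1n.
  have -> : (j.+1%:R ^+ 2)^-1 = expR (- (2 * ln (j.+1%:R : R))).
    by rewrite expRN mulrC expRM_natr lnK// posrE.
  rewrite -expRD ler_expR -opprD lerN2.
  apply: (@le_trans _ _ (th * (1 + p * ln (j.+1%:R : R)))).
    by rewrite mulrDr mulr1 lerD2l mulrA ler_wpM2r.
  rewrite ler_wpM2l//.
  by rewrite /powR gt_eqF ?ltr0n// expR_ge1Dx.
by rewrite -mulr_sumr mulrC ler_pM2r ?expR_gt0// sum_inv_sqr_le2.
Qed.

(** Coordinates below 1 / [phi m] become 0; the others are truncated towards 0, and [p_orlicz_lower]
    bounds the weight of the multiple. *)
Lemma quantize (m : R) B (x : R) : 1 <= m -> phi m < B%:R -> `|x| <= 1 ->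
  exists t : option (bool * 'I_B),
    [/\ `|x - quant_value (phi m)^-1 t| <= `|x|,
        `|x - quant_value (phi m)^-1 t| <= (phi m)^-1
      & quant_weight t <= m * M `|x|].
Proof.
move=> m1 phiB x1; set a := (phi m)^-1.
have f0 := fund_gt0 p0 oM m1; have a0 : 0 < a by rewrite invr_gt0.
have m0 : 0 < m by rewrite (lt_le_trans ltr01).
have [xa|ax] := ltP `|x| a.
  exists None; rewrite /= subr0 lexx (ltW xa); split=> //.
  by rewrite mulr_ge0// ?(ltW m0)// (p_orlicz_ge0 p0 oM).
pose b := Num.truncn (`|x| * phi m).
have xf1 : 1 <= `|x| * phi m by rewrite -ler_pdivrMr// mul1r.
have /andP[bl bu] : b%:R <= `|x| * phi m < b.+1%:R.
  by apply: truncn_itv; rewrite (le_trans ler01).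
have b0 : (0 < b)%N by move: (le_lt_trans xf1 bu); rewrite ltr1n ltnS.
have bB : (b.-1 < B)%N.
  rewrite prednK// -ltnS -(ltr_nat R) (le_lt_trans bl)//.
  rewrite (@le_lt_trans _ _ (phi m))// ?ler_piMl// ?(ltW f0)//.
  by rewrite (lt_trans phiB)// ltr_nat.
have bax : b%:R * a <= `|x| by rewrite ler_pdivrMr.
have xba : `|x| <= b%:R * a + a.
  by rewrite -[X in _ + X]mul1r -mulrDl natr1 ler_pdivlMr// ltW.
exists (Some (x < 0, Ordinal bB)) => /=; rewrite prednK//.
have -> : `|x - (-1) ^+ (x < 0)%R * (b%:R * a)| = `|x| - b%:R * a.
  rewrite {1}[x]numEsign -mulrBr normrM normr_sign mul1r ger0_norm//.
  by rewrite subr_ge0.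
split.
- by rewrite gerBl mulr_ge0// ltW.
- by rewrite lerBlDl.
- rewrite -ler_pdivrMl// mulrC; apply: le_trans (p_orlicz_lower p0 oM m1 ax x1).
  rewrite ler_pM2r ?invr_gt0//.
  by apply: ge0_ler_powR; rewrite ?nnegrE ?(ltW p0)// mulr_ge0// ltW.
Qed.

Lemma modular_ball_code n (m : R) : 1 <= m -> m <= n%:R ->
  exists (T : finType) (S : {set T}) (f : T -> 'rV[R]_n),
    #|S|%:R <= expR (m * (2 / p + 4 + ln (n%:R / m))) /\
    forall x : 'rV[R]_n, modular_ball M x -> exists2 t, t \in S &
      forall i, `|(x - f t) ord0 i| <= `|x ord0 i| /\
                `|(x - f t) ord0 i| <= (phi m)^-1.
Proof.
move=> m1 mn; have m0 : 0 < m by rewrite (lt_le_trans ltr01).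
have n0 : 0 < n%:R :> R by rewrite (lt_le_trans m0).
pose B := (Num.truncn (phi m)).+1.
have phiB : phi m < B%:R by rewrite truncnS_gt.
pose T : finType := {ffun 'I_n -> option (bool * 'I_B)}.
pose S : {set T} := [set c : T | \sum_i quant_weight (c i) <= m]%SET.
pose f (c : T) : 'rV[R]_n := \row_i quant_value (phi m)^-1 (c i).
exists T, S, f; split.
  (* The term 2/p meets the requirement th p >= 2; the logarithm gives exp (- th) <= m/n, so the n
     generating functions multiply to at most (1 + 4 m/n)^n <= exp (4 m). *)
  pose th := 2 / p + ln (n%:R / m).
  have lnm : 0 <= ln (n%:R / m) by rewrite ln_ge0// ler_pdivlMr// mul1r.
  have thp : 2 <= th * p.
    by rewrite mulrDl divfK ?gt_eqF// lerDl mulr_ge0// ltW.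
  have th0 : 0 <= th by rewrite addr_ge0// divr_ge0// ltW.
  apply: (le_trans (card_weight_le m (w := fun _ : 'I_n => @quant_weight B)
    th0 (fun=> quant_weight_gen B thp))).
  rewrite card_ord; apply: (@le_trans _ _ (expR (th * m) * expR (4 * m))).
    rewrite ler_pM2l ?expR_gt0//.
    have -> : 4 * m = (4 * (m / n%:R)) * n%:R.
      by rewrite mulrA divfK ?gt_eqF.
    rewrite expRM_natr lerXn2r ?nnegrE ?expR_ge0//.
    apply: (@le_trans _ _ (1 + 4 * (m / n%:R))); last exact: expR_ge1Dx.
    rewrite lerD2l ler_pM2l// -[leRHS]lnK ?posrE ?divr_gt0// ler_expR.
    rewrite -invf_div lnV ?posrE ?divr_gt0// lerN2 lerDr.
    by rewrite divr_ge0// ltW.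
  by rewrite -expRD ler_expR /th; lra.
move=> x [x1 Mx].
have /choice[c cP] := fun i => quantize m1 phiB (x1 i).
exists [ffun i => c i].
  rewrite inE; apply: (@le_trans _ _ (\sum_i m * M `|x ord0 i|)).
    by apply: ler_sum => i _; rewrite ffunE; case: (cP i).
  by rewrite -mulr_sumr ler_piMr// ltW.
by move=> i; rewrite !mxE ffunE; case: (cP i).
Qed.

End Coding.

Lemma natr_dist_lt1 (R : realDomainType) (a b : nat) :
  `|a%:R - b%:R| < 1 :> R -> a = b.
Proof.
have [ab|ba|//] := ltngtP a b; rewrite ltr_norml => /andP[h1 h2].
  by have h3 : a%:R + 1 <= b%:R :> R; [rewrite natr1 ler_nat|exfalso; lra].
by have h3 : b%:R + 1 <= a%:R :> R; [rewrite natr1 ler_nat|exfalso; lra].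
Qed.

(** * Pigeonhole and volume lower bounds; coverings from codes *)

Section Covering.
Context {R : realType} (p : R) (M1 M2 : R -> R).
Hypotheses (p0 : 0 < p) (oM1 : p_orlicz p M1) (oM2 : p_orlicz p M2).
Local Notation phi1 := (fundamental M1).
Local Notation phi2 := (fundamental M2).
Local Notation D := (expR (2 / p + 4)).
Variable n : nat.

Lemma covered_normr_le K r (y : 'I_K -> 'rV[R]_n) x i j : 0 < r ->
  modular_ball M2 (r^-1 *: (x - y i)) -> `|x ord0 j - y i ord0 j| <= r.
Proof.
move=> r0 [/(_ j) + _]; rewrite !mxE normrM gtr0_norm ?invr_gt0//.
by rewrite ler_pdivrMl// mulr1.
Qed.

(* Pigeonhole on the n + 1 points 0, e_1, ..., e_n, at mutual sup-distance 1. *)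
Lemma covered_ge_half K r : (K <= n)%N -> covered M1 M2 n K r -> 2^-1 <= r.
Proof.
move=> Kn [r0 [y ycov]].
(* Index 0 gives the zero vector, index j + 1 the unit vector at j. *)
pose x (c : 'I_n.+1) : 'rV[R]_n := \row_j (j.+1 == c :> nat)%:R.
have M1b (b : bool) : M1 `|b%:R| = b%:R.
  by case: b; rewrite ?normr1 ?normr0 ?(p_orlicz0 p0 oM1) ?(p_orlicz1 oM1).
have Bx c : modular_ball M1 (x c).
  split=> [j|]; first by rewrite mxE normr_nat lern1 leq_b1.
  rewrite (eq_bigr (fun j : 'I_n => (j.+1 == c :> nat)%:R)) => [|j _]; last first.
    by rewrite mxE M1b.
  rewrite -natr_sum lern1; have [c0|c_neq0] := eqVneq (c : nat) 0%N.
    by rewrite big1// => j _; rewrite c0.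
  have cn : (c.-1 < n)%N.
    by have := ltn_ord c; case: (nat_of_ord c) c_neq0.
  rewrite (bigD1 (Ordinal cn))//= big1 ?addn0 ?leq_b1// => j jc.
  apply/eqP; rewrite eqb0; apply: contra jc => /eqP jc.
  by apply/eqP/val_inj => /=; rewrite -jc.
have /choice[g gP] := fun c => ycov _ (Bx c).
have /injectivePn[c [c' cc' gcc']] : ~~ injectiveb g.
  apply/negP => /injectiveP/leq_card; rewrite !card_ord.
  by rewrite leqNgt ltnS Kn.
have h j : `|x c ord0 j - x c' ord0 j| <= 2 * r.
  have := covered_normr_le j r0 (gP c); have := covered_normr_le j r0 (gP c').
  rewrite gcc' [in X in X -> _]distrC => h1 h2.
  rewrite (le_trans (ler_distD (y (g c') ord0 j) _ _))// mulr2n mulrDl mul1r.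
  exact: lerD.
suff [j hj] : exists j, 1 <= `|x c ord0 j - x c' ord0 j|.
  by have := le_trans hj (h j); lra.
(* One of the two distinct indices is nonzero; its unit coordinate separates the points. *)
wlog c0 : c c' cc' {gcc' h} / (0 < c)%N => [hwlog|].
  have [c0|] := posnP c; last exact: hwlog.
  have c'0 : (0 < c')%N.
    rewrite lt0n; apply: contra cc' => /eqP c'0.
    by apply/eqP/val_inj; rewrite /= c0 c'0.
  have := hwlog c' c; rewrite eq_sym => /(_ cc' c'0)[j].
  by rewrite distrC; exists j.
have cn : (c.-1 < n)%N by have := ltn_ord c; case: (nat_of_ord c) c0.
exists (Ordinal cn); rewrite !mxE/= prednK// eqxx.
by rewrite (negbTE (_ : nat_of_ord c != c')) ?subr0 ?normr1.
Qed.

Lemma expR_code_full : (0 < n)%N ->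
  expR (n%:R * (2 / p + 4 + ln (n%:R / n%:R))) = D ^+ n.
Proof. by move=> n0; rewrite divff ?pnatr_eq0 -?lt0n// ln1 addr0 expRM_natl. Qed.

(* Volume argument: the modular ball of M2 lies in D^n cubes of half-side
   1 / phi2 n, while the modular ball of M1 contains a grid of q^n points of
   step 1 / (q phi1 n). *)
Lemma covered_ge_volume K q r : (0 < n)%N -> (0 < q)%N ->
  K%:R * D ^+ n < q%:R ^+ n -> covered M1 M2 n K r ->
  phi2 n%:R / phi1 n%:R / (2 * q%:R) <= r.
Proof.
move=> n0 q0 Kq [r0 [y ycov]]; rewrite leNgt; apply/negP => r_lt.
have n1 : 1 <= n%:R :> R by rewrite ler1n.
have f1 := fund_gt0 p0 oM1 n1; have f2 := fund_gt0 p0 oM2 n1.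
have qR0 : 0 < q%:R :> R by rewrite ltr0n.
have [T [S [f [Scard Scode]]]] := modular_ball_code p0 oM2 n1 (lexx n%:R).
rewrite expR_code_full// in Scard.
pose d := (q%:R * phi1 n%:R)^-1.
have d0 : 0 < d by rewrite invr_gt0 mulr_gt0.
pose x (c : {ffun 'I_n -> 'I_q}) : 'rV[R]_n := \row_j ((c j)%:R * d).
have Bx c : modular_ball M1 (x c).
  apply: (modular_ball_small p0 oM1 n1) => // j.
  rewrite mxE ger0_norm ?mulr_ge0 ?(ltW d0)// /d invfM mulrA.
  apply: ler_piMl; first by rewrite invr_ge0 ltW.
  by rewrite ler_pdivrMr// mul1r ler_nat ltnW.
(* A grid point goes to a centre covering it and the code of its rescaled difference from that
   centre. Points with the same image differ by at most 2 r / phi2 n per coordinate, less than the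
   step d, hence coincide. *)
have /choice[g gP] : forall c, exists it : 'I_K * T, it.2 \in S /\
    forall j, `|r^-1 * (x c ord0 j - y it.1 ord0 j) - f it.2 ord0 j|
      <= (phi2 n%:R)^-1.
  move=> c; have [i Bi] := ycov _ (Bx c).
  have [t tS ft] := Scode _ Bi; exists (i, t); split=> //= j.
  by have [_] := ft j; rewrite !mxE.
have g_inj : injective g.
  move=> c c' gcc'; apply/ffunP => j; apply/val_inj.
  have [_ /(_ j) h1] := gP c; have [_ /(_ j) h2] := gP c'.
  rewrite -gcc' in h2.
  have : `|r^-1 * (x c ord0 j - x c' ord0 j)| <= 2 / phi2 n%:R.
    rewrite mulrDl mul1r (le_trans _ (lerD h1 h2))//.
    rewrite (le_trans _ (ler_normB _ _))// le_eqVlt; apply/orP; left.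
    by apply/eqP; congr `| _ |; ring.
  rewrite normrM gtr0_norm ?invr_gt0// ler_pdivrMl// !mxE -mulrBl normrM.
  rewrite (gtr0_norm d0) => h3.
  have : `|(c j)%:R - (c' j)%:R| * d < d.
    apply: (le_lt_trans h3); move: r_lt; rewrite ltr_pdivlMr ?mulr_gt0// => h4.
    have -> : d = phi2 n%:R / phi1 n%:R / (q%:R * phi2 n%:R).
      by rewrite /d; field; rewrite !gt_eqF.
    have -> : r * (2 / phi2 n%:R) = r * (2 * q%:R) / (q%:R * phi2 n%:R).
      by field; rewrite !gt_eqF.
    by rewrite ltr_pM2r// invr_gt0 mulr_gt0.
  rewrite gtr_pMl// => h5; apply/eqP; move: h5.
  by move=> /natr_dist_lt1 cj; apply/eqP.
have /subset_leq_card : g @: [set: {ffun 'I_n -> 'I_q}]%SET \subset finset.setX [set: 'I_K]%SET S.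
  by apply/fintype.subsetP => _ /imsetP[c _ ->]; rewrite !inE; case: (gP c).
rewrite card_imset// cardsX !cardsT card_ffun !card_ord leqNgt => /negP; apply.
rewrite -(ltr_nat R) natrM natrX; apply: le_lt_trans Kq.
by rewrite ler_wpM2l.
Qed.

Hypothesis phi_mono : forall s t : R, 1 <= s -> s <= t ->
  phi1 s / phi2 s <= phi1 t / phi2 t.

(** Rounding errors are at most 1 / phi1 m, so [p_orlicz_compare] applies to them, and at most |x|,
    so their M1-modular stays at most 1. *)
Lemma covered_fund K (m : R) : 1 <= m -> m <= n%:R ->
  expR (m * (2 / p + 4 + ln (n%:R / m))) <= K%:R ->
  covered M1 M2 n K (phi2 m / phi1 m).
Proof.
move=> m1 mn Kcard; have [T [S [f [Scard Scode]]]] := modular_ball_code p0 oM1 m1 mn.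
have f1 := fund_gt0 p0 oM1 m1; have f2 := fund_gt0 p0 oM2 m1.
apply: (@covered_finset _ _ _ _ _ S f); first by rewrite divr_gt0.
  by rewrite -(ler_nat R) (le_trans Scard).
move=> x Bx; have [t tS ft] := Scode _ Bx; exists t => //.
have [x1 Mx] := Bx.
have E i : `|((phi2 m / phi1 m)^-1 *: (x - f t)) ord0 i| =
    phi1 m / phi2 m * `|(x - f t) ord0 i|.
  by rewrite mxE normrM invf_div gtr0_norm// divr_gt0.
split=> [i|].
  rewrite E; apply: (le_trans (fund_ratioK p0 oM1 oM2 m1 _ _)) => //.
    exact: (ft i).2.
  exact: (fundV_le1 p0 oM2).
apply: le_trans Mx; apply: ler_sum => i _; rewrite E.
apply: (le_trans (p_orlicz_compare p0 oM1 oM2 phi_mono m1 _ _)) => //.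
  exact: (ft i).2.
by apply: (p_orlicz_le p0 oM1) => //; exact: (ft i).1.
Qed.

(** Both endpoints of [-a, a] belong to the grid, hence L + 1 points for L steps; z is truncated to
    the grid point on its left. *)
Lemma subdivide (a z : R) L : 0 < a -> `|z| <= a -> (0 < L)%N ->
  exists c : 'I_L.+1, `|z - a * (2 * c%:R / L%:R - 1)| <= 2 * a / L%:R.
Proof.
move=> a0 za L0; have LR0 : 0 < L%:R :> R by rewrite ltr0n.
have [za1 za2] : - a <= z /\ z <= a by move: za; rewrite ler_norml => /andP[].
pose s := (z / a + 1) * L%:R / 2.
have s0 : 0 <= s.
  rewrite divr_ge0// mulr_ge0// ?(ltW LR0)// -lerBlDr sub0r.
  by rewrite ler_pdivlMr// mulN1r.
have /andP[cl cu] := truncn_itv s0; set c := Num.truncn s in cl cu.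
have cL : (c < L.+1)%N.
  rewrite ltnS -(ler_nat R) (le_trans cl)// ler_pdivrMr// mulrC ler_pM2l//.
  by rewrite -lerBrDr ler_pdivrMr//; lra.
exists (Ordinal cL) => /=.
have -> : z - a * (2 * c%:R / L%:R - 1) = (2 * a / L%:R) * (s - c%:R).
  by rewrite /s; field; rewrite !gt_eqF.
rewrite normrM ger0_norm ?divr_ge0 ?mulr_ge0 ?(ltW a0)//.
rewrite ler_piMr ?divr_ge0 ?mulr_ge0 ?(ltW a0)//.
by rewrite ger0_norm ?subr_ge0// lerBlDl natr1 ltW.
Qed.

(** The code at m = n leaves an error in a cube of half-side 1 / phi1 n; a grid in that cube refines
    it, and the remainder lies in an M2 ball by [modular_ball_small]. *)
Lemma covered_fine K L : (0 < n)%N -> (0 < L)%N ->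
  (D * L.+1%:R) ^+ n <= K%:R ->
  covered M1 M2 n K (2 / L%:R * (phi2 n%:R / phi1 n%:R)).
Proof.
move=> n0 L0 Kcard; have LR0 : 0 < L%:R :> R by rewrite ltr0n.
have n1 : 1 <= n%:R :> R by rewrite ler1n.
have f1 := fund_gt0 p0 oM1 n1; have f2 := fund_gt0 p0 oM2 n1.
have [T [S [f [Scard Scode]]]] := modular_ball_code p0 oM1 n1 (lexx n%:R).
rewrite expR_code_full// in Scard.
pose a := (phi1 n%:R)^-1; have a0 : 0 < a by rewrite invr_gt0.
have r0 : 0 < 2 / L%:R * (phi2 n%:R / phi1 n%:R) by rewrite mulr_gt0 ?divr_gt0.
pose F (tc : T * {ffun 'I_n -> 'I_L.+1}) : 'rV[R]_n :=
  f tc.1 + \row_i (a * (2 * (tc.2 i)%:R / L%:R - 1)).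
apply: (@covered_finset _ _ _ _ _ (finset.setX S [set: {ffun 'I_n -> 'I_L.+1}]%SET) F) => //.
  rewrite cardsX cardsT card_ffun !card_ord -(ler_nat R) natrM natrX.
  by rewrite (le_trans _ Kcard)// exprMn ler_wpM2r// exprn_ge0.
move=> x /Scode[t tS ft].
have /choice[c cP] := fun i => subdivide a0 (ft i).2 L0.
exists (t, [ffun i => c i]); first by rewrite !inE tS.
apply: (modular_ball_small p0 oM2 n1) => // i.
rewrite mxE normrM gtr0_norm ?invr_gt0// ler_pdivrMl//.
have := cP i; rewrite !mxE ffunE opprD addrA => /le_trans; apply.
rewrite le_eqVlt; apply/orP; left; apply/eqP; rewrite /a.
by field; rewrite !gt_eqF.
Qed.

End Covering.

(** [card_weight_le] with th = ln q, for which the generating function is 1 + (q - 1)/q <= 2. *)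
Lemma card_hamming_ball_le (R : realType) (m q : nat) (g : 'I_m -> 'I_q) :
  (0 < q)%N ->
  #|[set f : {ffun 'I_m -> 'I_q} |
      \sum_i (f i != g i)%:R <= m%:R / 2 :> R]%SET|%:R
    <= expR (ln q%:R * (m%:R / 2)) * 2 ^+ m :> R.
Proof.
move=> q0.
have := @card_weight_le R 'I_m 'I_q (fun i j => (j != g i)%:R) (m%:R / 2)
  (ln q%:R) 2; rewrite card_ord; apply; first by rewrite ln_ge0// ler1n.
move=> i; rewrite (bigD1 (g i))//= eqxx mulr0 oppr0 expR0.
rewrite -[leRHS]/(1 + 1) lerD2l.
apply: (@le_trans _ _ (\sum_(j < q) q%:R^-1)); last first.
  by rewrite sumr_const card_ord -[leLHS]mulr_natl divff// pnatr_eq0 -lt0n.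
rewrite [leRHS](bigD1 (g i))//= -[leLHS]add0r lerD ?invr_ge0//.
apply: ler_sum => j ->; rewrite mulr1 expRN lnK// posrE ltr0n//.
Qed.

(** * Block vectors and their decoding *)

Section BlockPacking.
Context {R : realType} (p : R) (M1 M2 : R -> R).
Hypotheses (p0 : 0 < p) (oM1 : p_orlicz p M1) (oM2 : p_orlicz p M2).
Local Notation phi1 := (fundamental M1).
Local Notation phi2 := (fundamental M2).
Variables (n m q : nat).
Hypotheses (m0 : (0 < m)%N) (q0 : (0 < q)%N) (mqn : (m * q <= n)%N).

Let m1 : 1 <= m%:R :> R. Proof. by rewrite ler1n. Qed.
Let a : R := (phi1 m%:R)^-1.

Let card_le : (#|{: 'I_m * 'I_q}| <= n)%N.
Proof. by rewrite card_prod !card_ord. Qed.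

Definition block_index (ij : 'I_m * 'I_q) : 'I_n :=
  widen_ord card_le (enum_rank ij).

Lemma block_index_inj : injective block_index.
Proof.
move=> ij ij' /(congr1 val)/= h; apply: enum_rank_inj; exact/val_inj.
Qed.

Definition block_support (f : {ffun 'I_m -> 'I_q}) : {set 'I_n} :=
  [set block_index (i, f i) | i in 'I_m]%SET.

Definition block_vector (f : {ffun 'I_m -> 'I_q}) : 'rV[R]_n :=
  \row_l (a * (l \in block_support f)%:R).

Lemma mem_block_support f i j :
  (block_index (i, j) \in block_support f) = (f i == j).
Proof.
apply/imsetP/eqP => [[i' _ /block_index_inj[-> ->]]//|<-].
by exists i.
Qed.

Lemma modular_ball_block f : modular_ball M1 (block_vector f).
Proof.
have a0 : 0 <= a by exact: fundV_ge0 p0 oM1 _ _.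
have a1 : a <= 1 by exact: fundV_le1 p0 oM1 _ _.
split=> [l|].
  rewrite mxE normrM ger0_norm// normr_nat.
  by case: (l \in _); rewrite ?mulr1 ?mulr0.
rewrite (eq_bigr (fun l : 'I_n => m%:R^-1 * (l \in block_support f)%:R)); last first.
  move=> l _; rewrite mxE normrM ger0_norm// normr_nat.
  by case: (l \in _); rewrite ?mulr1 ?mulr0 ?(p_orlicz0 p0 oM1)//
    (p_orlicz_fundV p0 oM1).
rewrite -mulr_sumr -natr_sum.
rewrite (_ : (\sum_(l < n) _)%N = #|block_support f|); last first.
  by rewrite -sum1_card [in RHS]big_mkcond; apply: eq_bigr => l _; case: ifP.
rewrite ler_pdivrMl ?ltr0n// mulr1 ler_nat.
by rewrite (leq_trans (leq_imset_card _ _))// card_ord.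
Qed.

(** The threshold a/2 is halfway between the possible entries 0 and a. If no coordinate passes it,
    the default index is harmless: y is then off by at least a/2 at the true one. *)
Definition block_decode (y : 'rV[R]_n) (i : 'I_m) : 'I_q :=
  odflt (Ordinal q0) [pick j | a / 2 < y ord0 (block_index (i, j))].

(* If f i differs from the decoded index, then one of the two coordinates of
   block i at these indices is off by at least a / 2. *)
Lemma block_decode_close (r : R) y f : 0 < r ->
  r < (2 * 2 `^ p^-1)^-1 * (phi2 m%:R / phi1 m%:R) ->
  modular_ball M2 (r^-1 *: (block_vector f - y)) ->
  \sum_i (f i != block_decode y i)%:R <= m%:R / 2 :> R.
Proof.
move=> r0 r_lt [B1 B2].
have f1 := fund_gt0 p0 oM1 m1; have f2 := fund_gt0 p0 oM2 m1.
have a0 : 0 < a by rewrite invr_gt0.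
have t0 : 0 < 2 `^ p^-1 :> R by rewrite powR_gt0.
have mR0 : 0 < m%:R :> R by rewrite ltr0n.
pose z l : R := `|(r^-1 *: (block_vector f - y)) ord0 l|.
have zE l : z l = r^-1 * `|a * (l \in block_support f)%:R - y ord0 l|.
  by rewrite /z !mxE normrM gtr0_norm// invr_gt0.
(* By [p_orlicz_lower] each such coordinate contributes at least 2/m to the M2-modular, so there are
   at most m/2 of them. *)
pose bad := [set l | 2 `^ p^-1 <= z l * phi2 m%:R]%SET.
have bad_le : #|bad|%:R <= m%:R / 2 :> R.
  have : #|bad|%:R * (2 / m%:R) <= 1 :> R.
    apply: le_trans B2; rewrite -sum1_card natr_sum mulr_suml.
    rewrite [leRHS](bigID (mem bad))/= -[leLHS]addr0 lerD//; last first.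
      by apply: sumr_ge0 => l _; apply: (p_orlicz_ge0 p0 oM2).
    apply: ler_sum => l; rewrite inE mul1r => zl.
    have : (phi2 m%:R)^-1 <= z l.
      rewrite -[leLHS]mul1r ler_pdivrMr//; apply: le_trans zl.
      by apply: powR_ge1; rewrite ?invr_ge0 ?(ltW p0)// ler1n.
    move=> /(p_orlicz_lower p0 oM2 m1)/(_ (B1 l)); apply: le_trans.
    rewrite ler_pM2r ?invr_gt0//.
    rewrite -[leLHS](@powRVK _ p 2) ?gt_eqF//.
    have zl0 : 0 <= z l by exact: normr_ge0.
    by apply: ge0_ler_powR; rewrite ?nnegrE ?mulr_ge0 ?(ltW p0) ?(ltW t0) ?(ltW f2).
  by rewrite mulrA ler_pdivrMr// mul1r ler_pdivlMr.
have mem_bad l : a / 2 <= `|a * (l \in block_support f)%:R - y ord0 l| -> l \in bad.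
  move=> hl; rewrite inE zE -mulrA ler_pdivlMl//.
  rewrite -ler_pdivrMr//; apply: le_trans hl; rewrite ler_pdivlMr// /a.
  move: r_lt; rewrite mulrC ltr_pdivlMr ?mulr_gt0// => /ltW h.
  rewrite -(ler_pM2r f2) (le_trans _ (le_trans h _))// le_eqVlt; apply/orP; left; apply/eqP.
    by field; rewrite gt_eqF.
  by field; rewrite gt_eqF.
apply: le_trans bad_le; rewrite -natr_sum ler_nat.
(* In a wrongly decoded block the true coordinate is off if y is small there; otherwise the decoded
   one is. Distinct blocks give distinct coordinates. *)
pose F i := block_index (i, if y ord0 (block_index (i, f i)) <= a / 2 then f i
                            else block_decode y i).
have F_inj : injective F by move=> i i' /block_index_inj[].
have -> : (\sum_i (f i != block_decode y i) = #|[set i | f i != block_decode y i]%SET|)%N.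
  by rewrite -sum1_card [in RHS]big_mkcond; apply: eq_bigr => i _; rewrite inE; case: (_ != _).
rewrite -(card_imset _ F_inj); apply: subset_leq_card.
apply/fintype.subsetP => _ /imsetP[i + ->]; rewrite inE => fi; apply: mem_bad; rewrite /F.
case: ifPn => [yl|]; rewrite mem_block_support ?eqxx ?mulr1.
  by rewrite ger0_norm; lra.
rewrite -ltNge (negbTE fi) mulr0 sub0r normrN => yg.
rewrite /block_decode; case: pickP => [j /= yj|/(_ (f i))]; last by rewrite yg.
by rewrite (le_trans (ltW yj))// ler_norm.
Qed.

(** For smaller r every choice function would lie in the Hamming ball of radius m/2 around the
    decoding of some centre, and K such balls are too small to contain all q^m of them. *)
Lemma covered_ge_blocks K r :
  K%:R * (expR (ln q%:R * (m%:R / 2)) * 2 ^+ m) < q%:R ^+ m :> R ->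
  covered M1 M2 n K r ->
  (2 * 2 `^ p^-1)^-1 * (phi2 m%:R / phi1 m%:R) <= r.
Proof.
move=> Kq [r0 [y ycov]]; rewrite leNgt; apply/negP => r_lt.
move: Kq; apply/negP; rewrite -leNgt.
pose F c := [set f : {ffun 'I_m -> 'I_q} |
  \sum_i (f i != block_decode (y c) i)%:R <= m%:R / 2 :> R]%SET.
apply: (@le_trans _ _ (\sum_(c < K) #|F c|%:R)); last first.
  rewrite mulr_natl -[in leRHS](card_ord K) -sumr_const; apply: ler_sum => c _.
  exact: card_hamming_ball_le.
have -> : q%:R ^+ m = \sum_(f : {ffun 'I_m -> 'I_q}) 1 :> R.
  by rewrite sumr_const card_ffun !card_ord natrX.
have -> : \sum_(c < K) #|F c|%:R =
    \sum_(f : {ffun 'I_m -> 'I_q}) \sum_(c < K) (f \in F c)%:R :> R.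
  rewrite exchange_big; apply: eq_bigr => c _.
  by rewrite -sum1_card natr_sum big_mkcond; apply: eq_bigr => f _; case: ifP.
apply: ler_sum => f _.
have [c /(block_decode_close r0 r_lt) fc] := ycov _ (modular_ball_block f).
by rewrite (bigD1 c)//= inE fc lerDl sumr_ge0.
Qed.

End BlockPacking.

(** * Elementary estimates for logarithms and powers of 2 *)

Section Log2.
Context {R : realType}.
Implicit Types x w : R.

Lemma ln2_le1 : ln 2 <= 1 :> R.
Proof. by have := @le_ln1Dx R 1; rewrite -[1 + 1]/2; apply; lra. Qed.

Lemma ln2_ge_half : 2^-1 <= ln 2 :> R.
Proof.
have h : ln (1 - 2^-1) <= - 2^-1 :> R by apply: le_ln1Dx; lra.
have e : 1 - 2^-1 = 2^-1 :> R by lra.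
by move: h; rewrite e lnV ?posrE// lerN2.
Qed.

Lemma ln2_gt0 : 0 < ln 2 :> R.
Proof. by apply: (lt_le_trans _ ln2_ge_half). Qed.

Lemma log2K x : log2 x * ln 2 = ln x.
Proof. by rewrite /log2 divfK// gt_eqF// ln2_gt0. Qed.

Lemma log2_2 : log2 2 = 1 :> R.
Proof. by rewrite /log2 divff// gt_eqF// ln2_gt0. Qed.

Lemma ler_log2 x w : 0 < x -> 0 < w -> (log2 x <= log2 w) = (x <= w).
Proof.
by move=> x0 w0; rewrite /log2 ler_pM2r ?invr_gt0 ?ln2_gt0// ler_ln.
Qed.

Lemma log2_exp2 k : log2 (2 ^+ k) = k%:R :> R.
Proof.
by rewrite /log2 lnXn// -[_ *+ k]mulr_natl mulfK// gt_eqF// ln2_gt0.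
Qed.

Lemma ln_le x : 0 < x -> ln x <= x.
Proof.
move=> x0; have := @le_ln1Dx R (x - 1); rewrite addrCA subrr addr0 => h.
by rewrite (le_trans (h _))//; lra.
Qed.

Lemma log2_le_double x : 0 < x -> log2 x <= 2 * x.
Proof.
move=> x0; rewrite /log2 ler_pdivrMr ?ln2_gt0//; apply: (le_trans (ln_le x0)).
rewrite mulrAC -[leLHS]mul1r ler_pM2r//.
by have := ln2_ge_half; lra.
Qed.

Lemma powR2_exp (n : nat) (x : R) : (2 `^ x) ^+ n = 2 `^ (x * n%:R).
Proof. by rewrite -powR_mulrn ?powR_ge0// powRrM. Qed.

Lemma powR2_div k n : (0 < n)%N -> (2 `^ (k%:R / n%:R)) ^+ n = 2 ^+ k :> R.
Proof.
by move=> n0; rewrite powR2_exp divfK ?pnatr_eq0 -?lt0n// powR_mulrn.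
Qed.

End Log2.

(* Chosen so that the code of modular_ball_code at m = upper_scale ^ 2 * u has at
   most 2 ^ (k / 2) words. *)
Definition upper_scale (R : realType) (p : R) : R := ln 2 / (2 * (2 / p + 8)).

(** The loss in [fund_ratio_le] on passing from m = [upper_scale p] ^ 2 * u to u. *)
Definition upper_const (R : realType) (p : R) : R :=
  (upper_scale p ^- 2) `^ p^-1.

(** * Bounds on covering radii in the ranges of k *)

Section Ranges.
Context {R : realType} (p : R) (M1 M2 : R -> R).
Hypotheses (p0 : 0 < p) (oM1 : p_orlicz p M1) (oM2 : p_orlicz p M2).
Local Notation phi1 := (fundamental M1).
Local Notation phi2 := (fundamental M2).
Local Notation D := (expR (2 / p + 4)).
Hypothesis phi_mono : forall s t : R, 1 <= s -> s <= t ->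
  phi1 s / phi2 s <= phi1 t / phi2 t.

Let D_ge2 : 2 <= D.
Proof.
apply: (le_trans _ (expR_ge1Dx _)).
by have : 0 <= 2 / p by [rewrite divr_ge0// ltW]; lra.
Qed.

Lemma fund_ratio_gt0 t : 1 <= t -> 0 < phi2 t / phi1 t.
Proof. by move=> t1; rewrite divr_gt0 ?(fund_gt0 p0 oM1) ?(fund_gt0 p0 oM2). Qed.

(** A converse to the monotonicity up to a constant: phi2 is non-decreasing, and phi1 grows by at
    most l^(1/p) by [fund_scale]. *)
Lemma fund_ratio_le (l s t : R) : 1 <= s -> s <= t -> t <= l * s ->
  phi2 s / phi1 s <= l `^ p^-1 * (phi2 t / phi1 t).
Proof.
move=> s1 st tls; have t1 := le_trans s1 st.
have s0 : 0 < s by rewrite (lt_le_trans ltr01).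
have l1 : 1 <= l by rewrite -(ler_pM2r s0) mul1r (le_trans st).
have f1 := fund_gt0 p0 oM1 s1; have f1' := fund_gt0 p0 oM1 t1.
have l0 : 0 < l `^ p^-1 by rewrite powR_gt0// (lt_le_trans ltr01).
rewrite ler_pdivrMr// mulrA mulrAC ler_pdivlMr// mulrAC [leRHS]mulrC.
apply: ler_pM.
- exact/ltW/(fund_gt0 p0 oM2).
- exact: ltW.
- exact: (fund_le p0 oM2).
- apply: le_trans (fund_scale p0 oM1 l1 s1).
  exact: (fund_le p0 oM1).
Qed.

(** The volume bound with an integer q between 2^(k/n) D and twice that, so that q^n exceeds 2^(k-1)
    D^n. *)
Lemma covered_ge_all k n r : (0 < k)%N -> (0 < n)%N ->
  covered M1 M2 n (2 ^ k.-1) r ->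
  2 `^ (- (k%:R / n%:R)) * (phi2 n%:R / phi1 n%:R) / (4 * D) <= r.
Proof.
move=> k0 n0 rcov; have A0 := @fund_ratio_gt0 n%:R; rewrite ler1n in A0.
have {A0} := A0 n0; set A := phi2 _ / phi1 _ => A0.
set x : R := 2 `^ (k%:R / n%:R); have x1 : 1 <= x.
  by apply: powR_ge1; rewrite ?divr_ge0// ler1n.
have x0 : 0 < x := lt_le_trans ltr01 x1.
have D0 : 0 < D by exact: expR_gt0.
have xD1 : 1 <= x * D by rewrite mulr_ege1// (le_trans _ D_ge2)// ler1n.
have xD0 : 0 <= x * D by rewrite (le_trans ler01).
pose q := (Num.truncn (x * D)).+1.
have q_gt : x * D < q%:R by rewrite truncnS_gt.
have q_le : q%:R <= 2 * (x * D).
  have -> : q%:R = (Num.truncn (x * D))%:R + 1 :> R by rewrite natr1.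
  have /andP[h _] := truncn_itv xD0.
  by apply: (le_trans (lerD h xD1)); move: (x * D) => z; lra.
have q0 : 0 < q%:R :> R by rewrite ltr0n.
have Kq : (2 ^ k.-1)%:R * D ^+ n < q%:R ^+ n.
  apply: (@le_lt_trans _ _ ((x * D) ^+ n)); last first.
    by rewrite ltrXn2r// ?nnegrE// ?(ltW q0)// -lt0n.
  rewrite exprMn powR2_div// ler_pM2r ?exprn_gt0// natrX.
  by rewrite ler_eXn2l ?ltr1n// leq_pred.
have := covered_ge_volume p0 oM1 oM2 n0 (ltn0Sn _ : (0 < q)%N) Kq rcov.
apply: le_trans; rewrite powRN -/x -/A.
rewrite ler_pdivlMr ?mulr_gt0// mulrAC ler_pdivrMr ?mulr_gt0//.
rewrite -mulrA ler_pdivrMl// [leRHS]mulrCA ler_pM2l//.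
by move: q_le; lra.
Qed.

(** * The range k <= n, with w = 2n/k, L = log w and u = k/L *)

Section Middle.
Variables (k n : nat) (w L u : R).
Hypotheses (k0 : (0 < k)%N) (kn : (k <= n)%N) (w2 : 2 <= w).
Hypotheses (wk : w * k%:R = 2 * n%:R) (LE : L = log2 w).
Hypotheses (uL : u * L = k%:R) (u1 : 1 <= u).

Let w0 : 0 < w. Proof. exact: lt_le_trans w2. Qed.

Let L1 : 1 <= L. Proof. by rewrite LE -(@log2_2 R) ler_log2. Qed.

Let u0 : 0 < u. Proof. exact: lt_le_trans u1. Qed.

Let uk : u <= k%:R. Proof. by rewrite -uL ler_peMr// ltW. Qed.

Let un : u <= n%:R. Proof. by rewrite (le_trans uk)// ler_nat. Qed.

Let n_div_u : n%:R / u = w * (L / 2).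
Proof.
have -> : n%:R = w * k%:R / 2 by rewrite wk mulrAC divff ?mul1r.
by rewrite -uL; field; rewrite gt_eqF.
Qed.

Let n_div_u_le : n%:R / u <= w ^+ 2.
Proof.
by rewrite n_div_u expr2 ler_pM2l// ler_pdivrMr// mulrC LE log2_le_double.
Qed.

Local Notation s := (upper_scale p).

Let p2 : 0 < 2 / p. Proof. by rewrite divr_gt0. Qed.

Let s0 : 0 < s.
Proof. by rewrite divr_gt0 ?ln2_gt0// mulr_gt0// addr_gt0. Qed.

Let s1 : s <= 2^-1.
Proof.
rewrite ler_pdivrMr ?mulr_gt0 ?addr_gt0//.
by move: p2 (@ln2_le1 R); move: (2 / p) (ln 2) => x y; lra.
Qed.

Let sE : s * (2 / p + 8) = ln 2 / 2.
Proof.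
by rewrite /upper_scale invfM mulrA divfK// gt_eqF// addr_gt0.
Qed.

Lemma covered_middle : exists2 r, covered M1 M2 n (2 ^ k.-1) r &
  r <= upper_const p * (phi2 u / phi1 u).
Proof.
pose m := s ^+ 2 * u.
have c0 : 0 < s ^+ 2 by rewrite exprn_gt0.
have c1 : s ^+ 2 <= 2^-1.
  by rewrite expr2 (le_trans _ s1)// ler_piMl ?(ltW s0)// (le_trans s1)// invf_le1// ler1n.
have mu2 : m <= 2^-1 * u by rewrite ler_pM2r.
have mu : m <= u by move: u0 mu2; lra.
have uE : u = s ^- 2 * m by rewrite /m mulKf// gt_eqF.
(* For m < 1 the radius 1 suffices: u is then bounded, and the ratio at u is comparable to its value
   1 at 1. *)
have [m1|m1] := ltP m 1.
  exists 1; first by apply: (covered1 p0 oM1 oM2 n phi_mono); rewrite expn_gt0.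
  have := @fund_ratio_le (s ^- 2) 1 u (lexx 1) u1.
  rewrite (fund1 p0 oM1) (fund1 p0 oM2) divr1 mulr1; apply.
  by rewrite uE ler_piMr ?invr_ge0// ltW.
exists (phi2 m / phi1 m); last first.
  by apply: fund_ratio_le => //; rewrite -uE.
have m0 : 0 < m by rewrite mulr_gt0.
apply: (covered_fund p0 oM1 oM2 phi_mono) => //; first exact: le_trans un.
(* From 1 <= m <= u/2 and u <= k; it ensures k/2 <= k - 1 at the end. *)
have k2 : 2 <= k%:R :> R by move: uk; lra.
have sle1 : s <= 1 by move: s1; lra.
have l2 := @ln2_gt0 R; have l2' := @ln2_le1 R.
rewrite natrX -[leRHS]lnK ?posrE ?exprn_gt0// ler_expR lnXn// -[leRHS]mulr_natl.
have lnnm : ln (n%:R / m) <= 2 * (L * ln 2) + 2 * s^-1.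
  have -> : n%:R / m = n%:R / u * s^-1 ^+ 2.
    by rewrite /m invfM exprVn mulrA mulrAC.
  apply: (@le_trans _ _ (ln (w ^+ 2 * s^-1 ^+ 2))).
    by rewrite ler_ln ?posrE ?mulr_gt0 ?divr_gt0 ?exprn_gt0 ?invr_gt0// ?ler_pM2r
      ?exprn_gt0 ?invr_gt0// (lt_le_trans u0).
  rewrite lnM ?posrE ?exprn_gt0 ?invr_gt0// !lnXn ?invr_gt0// LE log2K.
  have sV0 : 0 < s^-1 by rewrite invr_gt0.
  by have := ln_le sV0; rewrite !mulr2n; move: (ln s^-1) (ln w) => *; lra.
apply: (@le_trans _ _ (m * (2 / p + 4 + (2 * (L * ln 2) + 2 * s^-1)))).
  by rewrite ler_pM2l// lerD2l.
(* The summands add up to at most s k (2/p + 8) = k ln 2 / 2. *)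
have -> : m * (2 / p + 4 + (2 * (L * ln 2) + 2 * s^-1)) =
    s * (s * u) * (2 / p + 4) + 2 * (s * s * k%:R * ln 2) + 2 * (s * u).
  by rewrite /m -uL; field; rewrite !gt_eqF.
have h1 : s * (s * u) * (2 / p + 4) <= s * k%:R * (2 / p + 4).
  by rewrite ler_pM2r ?addr_gt0// ler_pM2l// (le_trans _ uk)// ler_piMl// ltW.
have h2 : s * s * k%:R * ln 2 <= s * k%:R.
  apply: (@le_trans _ _ (s * s * k%:R)).
    by apply: ler_piMr => //; apply: mulr_ge0 => //; apply: mulr_ge0; exact: ltW.
  by rewrite ler_wpM2r// ler_piMl// ltW.
have h3 : s * u <= s * k%:R by rewrite ler_pM2l.
have h4 : s * k%:R * (2 / p + 4) + 4 * (s * k%:R) = k%:R * ln 2 / 2.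
  by rewrite -[k%:R * ln 2 / 2]mulrA -sE; ring.
have -> : k.-1%:R = k%:R - 1 :> R by rewrite -subn1 natrB.
have h5 : 0 <= (k%:R - 2) * ln 2 :> R by apply: mulr_ge0; [rewrite subr_ge0|exact: ltW].
have h6 : (k%:R - 2) * ln 2 = k%:R * ln 2 - 2 * ln 2 :> R by ring.
rewrite mulrBl mul1r.
by clear lnnm; lra.
Qed.

(* The hypothesis on W keeps tactics from unfolding the numeral 1296. *)
Lemma covered_ge_middle W r : W = 36 * 36 -> covered M1 M2 n (2 ^ k.-1) r ->
  phi2 u / phi1 u / (8 * D * (W ^+ 2) `^ p^-1) <= r.
Proof.
move=> WE rcov; have n0 : (0 < n)%N := leq_trans k0 kn.
have kR0 : 0 < k%:R :> R by rewrite ltr0n.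
have nR0 : 0 < n%:R :> R by rewrite ltr0n.
have Au0 := fund_ratio_gt0 u1; set A := phi2 u / phi1 u in Au0 *.
have D0 : 0 < D by exact: expR_gt0.
have pV0 : 0 <= p^-1 by rewrite invr_ge0 ltW.
have W0 : 0 < W by rewrite WE mulr_gt0.
set E : R := (W ^+ 2) `^ p^-1; have E0 : 0 < E by rewrite powR_gt0// exprn_gt0.
rewrite ler_pdivrMr ?mulr_gt0//.
have nE : n%:R = w * (L / 2) * u by rewrite -n_div_u divfK// gt_eqF.
(* For w <= W one has n <= W^2 u, so passing from u to n costs the factor E, and 2^(-k/n) >= 1/2. *)
have [w_le|w_gt] := leP w W.
  have An : A <= E * (phi2 n%:R / phi1 n%:R).
    apply: fund_ratio_le => //; rewrite -ler_pdivrMr//.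
    apply: (le_trans n_div_u_le); rewrite lerXn2r// nnegrE// ltW//.
  have := covered_ge_all k0 n0 rcov; rewrite ler_pdivrMr ?mulr_gt0//.
  have h2 : 2^-1 <= 2 `^ (- (k%:R / n%:R)) :> R.
    rewrite -powR_inv1//; apply: ler_powR; first by rewrite ler1n.
    by rewrite lerN2 ler_pdivrMr// mul1r ler_nat.
  have A0 : 0 < phi2 n%:R / phi1 n%:R by apply: fund_ratio_gt0; rewrite ler1n.
  have h3 : 2^-1 * (phi2 n%:R / phi1 n%:R) <=
      2 `^ (- (k%:R / n%:R)) * (phi2 n%:R / phi1 n%:R) by rewrite ler_pM2r.
  move=> h4; have {h3 h4} h := le_trans h3 h4.
  apply: (le_trans An); rewrite (_ : r * _ = E * (2 * (r * (4 * D)))); last by ring.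
  rewrite ler_pM2l//.
  by move: h; move: (phi2 _ / _) (r * (4 * D)) => x y; lra.
pose m := (Num.truncn (8 * u)).+1.
have u8 : 0 <= 8 * u by rewrite mulr_ge0// ltW.
have m_gt : 8 * u < m%:R by rewrite truncnS_gt.
have m_le : m%:R <= 9 * u.
  have -> : m%:R = (Num.truncn (8 * u))%:R + 1 :> R by rewrite natr1.
  have /andP[h _] := truncn_itv u8.
  by apply: (le_trans (lerD h u1)); lra.
have um : u <= m%:R by move: u0 m_gt; lra.
have mn : (m <= n)%N.
  rewrite -(ler_nat R) (le_trans m_le)// nE ler_pM2r//.
  by rewrite (@le_trans _ _ (w * (1 / 2)))// ?ler_pM2l ?ler_pM2r//; lra.
pose q := (n %/ m)%N.
have q0 : (0 < q)%N by rewrite divn_gt0.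
have mqn : (m * q <= n)%N by rewrite mulnC leq_trunc_div.
have nq : n%:R <= 2 * q%:R * (9 * u) :> R.
  apply: (@le_trans _ _ (2 * q%:R * m%:R)); last by rewrite ler_pM2l// mulr_gt0// ltr0n.
  rewrite -!natrM ler_nat; apply: (leq_trans (ltnW (ltn_ceil n (ltn0Sn _ : (0 < m)%N)))).
  by rewrite leq_mul2r mul2n -addnn -addn1 leq_add2l q0 orbT.
(* From m <= 9u and n <= 2qm one gets q >= wL/36 >= w/36; squaring and w > 36^2 give the claim. *)
have wq : w <= q%:R ^+ 2.
  have hq : w / 36 <= q%:R.
    move: nq; rewrite nE [leRHS]mulrA ler_pM2r// => nq.
    have hL : w * 1 <= w * L by rewrite ler_pM2l.
    by move: hL nq; rewrite mulr1 mulrA; move: (w * L) => z; lra.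
  apply: (@le_trans _ _ ((w / 36) ^+ 2)); last first.
    by rewrite lerXn2r// nnegrE ?divr_ge0// ltW.
  rewrite expr2 mulrA -[leLHS]mulr1 -mulrA -mulrA ler_pM2l//.
  by rewrite mulrCA -invfM -WE ler_pdivlMr// mul1r ltW.
have qR0 : 0 < q%:R :> R by rewrite ltr0n.
have lnq : L * ln 2 <= 2 * ln q%:R.
  by rewrite LE log2K mulr_natl -lnXn// ler_ln ?posrE ?exprn_gt0.
have L8 : 8 <= L.
  rewrite LE -(@log2_exp2 R 8) ler_log2// ?exprn_gt0// (le_trans _ (ltW w_gt))//.
  by rewrite WE; move: w_gt => _; lra.
have l2 := @ln2_gt0 R.
(* Half of m ln q goes to the Hamming ball. As m > 8u and L >= 8, each of k ln 2 and m ln 2 is at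
   most a quarter; replacing k by k - 1 makes the inequality strict. *)
have Kq : (2 ^ k.-1)%:R * (expR (ln q%:R * (m%:R / 2)) * 2 ^+ m) < q%:R ^+ m :> R.
  have expE (a b : nat) : (0 < a)%N -> a%:R ^+ b = expR (b%:R * ln a%:R) :> R.
    by move=> a0; rewrite expRM_natl lnK// posrE ltr0n.
  rewrite natrX !expE// -!expRD ltr_expR.
  have -> : k.-1%:R = k%:R - 1 :> R by rewrite -subn1 natrB.
  have mR0 : 0 < m%:R :> R by rewrite ltr0n.
  have h1 : m%:R * (L * ln 2) <= m%:R * (2 * ln q%:R) by rewrite ler_pM2l.
  have h2 : 8 * (k%:R * ln 2) <= m%:R * (L * ln 2).
    rewrite -uL !mulrA ler_pM2r// ler_pM2r ?(ltW m_gt)//.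
    exact: lt_le_trans L1.
  have h3 : 8 * (m%:R * ln 2) <= m%:R * (L * ln 2).
    by rewrite mulrCA ler_pM2l// ler_pM2r.
  move: h1 h2 h3 l2; move: (ln q%:R) (ln 2) (m%:R : R) (k%:R : R) => a b c d.
  by lra.
have := covered_ge_blocks p0 oM1 oM2 (ltn0Sn _ : (0 < m)%N) q0 mqn Kq rcov.
have Am : A <= 9 `^ p^-1 * (phi2 m%:R / phi1 m%:R) by apply: fund_ratio_le.
have t0 : 0 < 2 `^ p^-1 :> R by rewrite powR_gt0.
have t9 : 0 < 9 `^ p^-1 :> R by rewrite powR_gt0.
rewrite ler_pdivrMl ?mulr_gt0// => h.
have r0 : 0 < r by case: rcov.
apply: (le_trans Am); apply: (@le_trans _ _ (9 `^ p^-1 * (2 * 2 `^ p^-1 * r))).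
  by rewrite ler_pM2l.
(* The base 18 collects 9 from m <= 9u and 2 from the decoding; it is at most W^2. *)
have -> : 9 `^ p^-1 * (2 * 2 `^ p^-1 * r) = r * (2 * 18 `^ p^-1).
  have -> : 18 = 9 * 2 :> R by rewrite -natrM.
  by rewrite powRM//; ring.
rewrite ler_pM2l//; apply: ler_pM; rewrite ?powR_ge0//.
  by move: D_ge2; lra.
apply: ge0_ler_powR; rewrite ?nnegrE ?exprn_ge0 ?(ltW W0)//.
by rewrite WE; lra.
Qed.

End Middle.

Lemma upper_const_ge1 : 1 <= upper_const p.
Proof.
have p2 : 0 < 2 / p by rewrite divr_gt0.
apply: powR_ge1; first by rewrite invr_ge0 ltW.
have d0 : 0 < 2 * (2 / p + 8) by rewrite mulr_gt0// addr_gt0.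
have s0 : 0 < upper_scale p by rewrite divr_gt0// ln2_gt0.
rewrite invf_ge1 ?exprn_gt0// expr_le1 ?(ltW s0)//.
rewrite ler_pdivrMr// mul1r.
by move: p2 (@ln2_le1 R); move: (2 / p) (ln 2) => x y; lra.
Qed.

(** With x = 2^((k-1)/n), the cubes at m = n are subdivided when x >= 2D. Otherwise 2^(-k/n) is
    bounded below and the covering for k = n is reused. *)
Lemma covered_high k n : (0 < n)%N -> (n <= k)%N ->
  exists2 r, covered M1 M2 n (2 ^ k.-1) r &
  r <= 12 * D * upper_const p *
    (2 `^ (- (k%:R / n%:R)) * (phi2 n%:R / phi1 n%:R)).
Proof.
move=> n0 nk; have nR1 : 1 <= n%:R :> R by rewrite ler1n.
have nR0 : 0 < n%:R :> R by rewrite ltr0n.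
have A0 := fund_ratio_gt0 nR1; set A := phi2 _ / phi1 _ in A0 *.
have D0 : 0 < D by exact: expR_gt0.
have C1 := upper_const_ge1; set C := upper_const p in C1 *.
have C0 : 0 < C := lt_le_trans ltr01 C1.
pose x : R := 2 `^ (k.-1%:R / n%:R).
have x0 : 0 < x by rewrite powR_gt0.
have xV : (2 * x)^-1 <= 2 `^ (- (k%:R / n%:R)).
  rewrite powRN lef_pV2 ?posrE ?powR_gt0 ?mulr_gt0//.
  have kE : k%:R = k.-1%:R + 1 :> R by rewrite natr1 prednK// (leq_trans n0 nk).
  rewrite kE mulrDl mul1r powRD; last first.
    by apply/implyP => _; rewrite pnatr_eq0.
  rewrite -/x mulrC ler_pM2r// -[leRHS]powRr1//.
  by apply: ler_powR; rewrite ?ler1n// invf_le1.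
have [Dx|xD] := leP (2 * D) x.
  (* With L = N - 1 >= 1 the count (D (L + 1))^n is at most x^n = 2^(k-1). *)
  pose N := Num.truncn (x / D).
  have t2 : 2 <= x / D by rewrite ler_pdivlMr.
  have t0 : 0 <= x / D by rewrite (le_trans _ t2).
  have /andP[Nl Nu] := truncn_itv t0; rewrite -/N in Nl Nu.
  have N2 : (2 <= N)%N by move: (le_lt_trans t2 Nu); rewrite ltr_nat ltnS.
  have L0 : (0 < N.-1)%N by rewrite -ltnS prednK// (ltn_trans _ N2).
  have NE : N.-1.+1 = N by rewrite prednK// (ltn_trans _ N2).
  exists (2 / N.-1%:R * A).
    apply: (covered_fine p0 oM1 oM2 n0 L0); rewrite NE natrX -(powR2_div k.-1 n0).
    rewrite lerXn2r ?nnegrE ?mulr_ge0 ?(ltW D0) ?powR_ge0//.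
    by rewrite mulrC -ler_pdivlMr.
  rewrite mulrA ler_pM2r//.
  have LR : x / D <= 3 * N.-1%:R.
    apply: (le_trans (ltW Nu)); rewrite -NE -natr1 -natr1.
    have : 1 <= N.-1%:R :> R by rewrite ler1n.
    by move: (N.-1%:R) => z; lra.
  have LR0 : 0 < N.-1%:R :> R by rewrite ltr0n.
  apply: (@le_trans _ _ (12 * D * (2 * x)^-1)).
    rewrite ler_pdivrMr// mulrAC ler_pdivlMr ?mulr_gt0//.
    by move: LR; rewrite ler_pdivrMr// mulrAC; lra.
  have D12 : 0 <= 12 * D by rewrite mulr_ge0// ltW.
  by apply: ler_pM => //; [rewrite invr_ge0 mulr_ge0// ltW|rewrite ler_peMr].
(* At k = n the parameters are w = 2, L = 1 and u = n. *)
have [||||r rcov r_le] := @covered_middle n n 2 1 n%:R n0 (leqnn n) (lexx 2).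
- by [].
- by rewrite log2_2.
- by rewrite mulr1.
- by [].
exists r; first by apply: covered_widen rcov; rewrite leq_exp2l// -!subn1 leq_sub2r.
apply: (le_trans r_le); rewrite -/A -/C mulrA ler_pM2r//.
rewrite mulrAC -[leLHS]mul1r ler_pM2r//.
apply: (@le_trans _ _ (12 * D * (2 * x)^-1)); last first.
  by rewrite ler_pM2l ?mulr_gt0.
rewrite ler_pdivlMr ?mulr_gt0//; move: xD; lra.
Qed.

End Ranges.

(** * Choice of the constants and assembly of the three ranges *)

Theorem theorem4p2 (R : realType) (p : R) (hp0 : 0 < p) (hp1 : p <= 1) :
  exists c1 c2 : R, [/\ 0 < c1, 0 < c2 &
    forall M1 M2 : R -> R,
      p_orlicz p M1 -> p_orlicz p M2 ->
      (forall s t : R, 1 <= s -> s <= t ->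
         fundamental M1 s / fundamental M2 s <=
         fundamental M1 t / fundamental M2 t) ->
      forall k n : nat, (0 < k)%N -> (0 < n)%N ->
        let e := @entropy_number R 'rV[R]_n 'rV[R]_n
                   (@orlicz_norm R M1 n) (@orlicz_norm R M2 n) idfun k in
        let u : R := k%:R / log2 (2 * n%:R / k%:R) in
        let A2 : R := fundamental M2 u / fundamental M1 u in
        let A3 : R := 2 `^ (- (k%:R / n%:R)) *
                      (fundamental M2 n%:R / fundamental M1 n%:R) in
        [/\ k%:R <= log2 (2 * n%:R : R) -> c1 * 1 <= e <= c2 * 1,
            log2 (2 * n%:R : R) <= k%:R -> (k <= n)%N -> c1 * A2 <= e <= c2 * A2
          & (n <= k)%N -> c1 * A3 <= e <= c2 * A3]].
Proof.
pose W : R := 36 * 36; pose D := expR (2 / p + 4); pose E := (W ^+ 2) `^ p^-1.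
pose C := upper_const p.
have D0 : 0 < D by exact: expR_gt0.
have D1 : 1 <= D.
  by rewrite -[leLHS]expR0 ler_expR addr_ge0// divr_ge0// ltW.
have W0 : 0 < W by rewrite mulr_gt0.
have E1 : 1 <= E.
  apply: powR_ge1; first by rewrite invr_ge0 ltW.
  by rewrite exprn_ege1// /W; lra.
have E0 : 0 < E := lt_le_trans ltr01 E1.
have C1 : 1 <= C := upper_const_ge1 hp0.
have C0 : 0 < C := lt_le_trans ltr01 C1.
have DE1 : 1 <= D * E by rewrite mulr_ege1.
have DC1 : 1 <= D * C by rewrite mulr_ege1.
have c1V : 0 < 16 * (D * E) by rewrite !mulr_gt0.
have c1_ge X : 0 <= X -> forall e d : R, 0 < d -> d <= 16 * (D * E) ->
    X / d <= e -> (16 * (D * E))^-1 * X <= e.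
  move=> X0 e d d0 d_le; apply: le_trans.
  by rewrite mulrC ler_wpM2l// lef_pV2.
(* The lower bounds lose the factors 4, 16 D E and 8 D; the upper bounds are 2, 2 C and 24 D C times
   the respective value. *)
exists (16 * (D * E))^-1, (24 * (D * C)); split.
- by rewrite invr_gt0.
- by rewrite !mulr_gt0.
move=> M1 M2 oM1 oM2 phi_mono k n k0 n0 e u A2 A3.
have nR0 : 0 < n%:R :> R by rewrite ltr0n.
have kR0 : 0 < k%:R :> R by rewrite ltr0n.
have A3_gt0 : 0 < A3.
  by rewrite mulr_gt0 ?powR_gt0// (fund_ratio_gt0 hp0 oM1 oM2)// ler1n.
have e_le r : covered M1 M2 n (2 ^ k.-1) r -> e <= 2 * r.
  exact: (entropy_le hp0 oM1).
have e_ge c : (forall r, covered M1 M2 n (2 ^ k.-1) r -> c <= r) -> c / 2 <= e.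
  exact: (entropy_ge hp0 oM1 oM2 (covered_exists hp0 oM1 oM2 n phi_mono k)).
split=> [k_le|k_ge kn|nk].
(* The bound k <= log (2n) says that there are at most n centres, as the pigeonhole argument
   requires. *)
- have Kn : (2 ^ k.-1 <= n)%N.
    have : 2 ^+ k <= 2 * n%:R :> R.
      by rewrite -ler_log2 ?exprn_gt0 ?mulr_gt0// log2_exp2.
    by rewrite -{1}(prednK k0) exprS ler_pM2l// -natrX ler_nat.
  apply/andP; split.
    apply: (@c1_ge 1 ler01 e 4) => //; first by move: DE1; move: (D * E) => z; lra.
    have := e_ge 2^-1 (fun r => covered_ge_half hp0 oM1 Kn).
    by rewrite -invfM mul1r (_ : 2 * 2 = 4 :> R)// -natrM.
  have K0 : (0 < 2 ^ k.-1)%N by rewrite expn_gt0.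
  have := e_le 1 (covered1 hp0 oM1 oM2 n phi_mono K0); rewrite !mulr1.
  by move: DC1; move: (D * C) => z; lra.
- pose w : R := 2 * n%:R / k%:R.
  have w2 : 2 <= w by rewrite ler_pdivlMr// ler_pM2l// ler_nat.
  have w0 : 0 < w by exact: lt_le_trans w2.
  have wk : w * k%:R = 2 * n%:R by rewrite divfK// gt_eqF.
  have L1 : 1 <= log2 w by rewrite -(@log2_2 R) ler_log2.
  have L0 : 0 < log2 w by exact: lt_le_trans L1.
  have uL : u * log2 w = k%:R by rewrite divfK// gt_eqF.
  (* Here log (2n/k) <= log (2n) <= k. *)
  have u1 : 1 <= u.
    rewrite ler_pdivlMr// mul1r (le_trans _ k_ge)// ler_log2// ?mulr_gt0//.
    by rewrite ler_pdivrMr// ler_peMr ?mulr_ge0// ler1n.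
  have A2_gt0 : 0 < A2 by exact: (fund_ratio_gt0 hp0 oM1 oM2).
  apply/andP; split.
    apply: (@c1_ge _ (ltW A2_gt0) e (8 * D * E * 2)); first by rewrite !mulr_gt0.
      by rewrite [leLHS](_ : _ = 16 * (D * E))//; ring.
    rewrite invfM mulrA; apply: e_ge => r.
    exact: (covered_ge_middle hp0 oM1 oM2 k0 kn w2 wk (erefl _) uL u1 (erefl W)).
  have [r /e_le er r_le] :=
    covered_middle hp0 oM1 oM2 phi_mono k0 kn w2 wk (erefl _) uL u1.
  apply: (le_trans er); rewrite -/C -/A2 in r_le.
  apply: (@le_trans _ _ (2 * (C * A2))); first by rewrite ler_pM2l.
  rewrite mulrA ler_pM2r//.
  have : C <= D * C by rewrite ler_peMl// ltW.
  by move: C0; move: (D * C) => z; lra.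
- apply/andP; split.
    apply: (@c1_ge _ (ltW A3_gt0) e (4 * D * 2)); first by rewrite !mulr_gt0.
      have : D <= D * E by rewrite ler_peMr// ltW.
      by move: D0; move: (D * E) => z; lra.
    by rewrite invfM mulrA; apply: e_ge => r; exact: covered_ge_all.
  have [r /e_le er r_le] := covered_high hp0 oM1 oM2 phi_mono n0 nk.
  apply: (le_trans er); rewrite -/C -/A3 -/D in r_le.
  apply: (@le_trans _ _ (2 * (12 * D * C * A3))); first by rewrite ler_pM2l.
  by rewrite (_ : 2 * _ = 24 * (D * C) * A3)//; ring.
Qed.
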